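(* Let $\mathbf{h}=(h_0,\dots,h_s)=(1,3,h_2,\dots,h_{t-1},h_t,h_t,\dots,h_t,h_{t-1},\dots,h_2,3,1)$ be an SI-sequence and let $a_i=h_i-h_{i-1}$ for $0\le i\le t$ (with $h_{-1}=0$). Let $A_i=[\alpha_i:\beta_i]\in\mathbb{P}^1$, $i=0,1,2,3$, be four distinct points with $\alpha_i\beta_i\ne 0$ and $A_i\notin\mathcal{W}$, let $\mathcal{A}=\{A_0,A_1,A_2,A_3\}$, and let $\mathcal{I}(t+1)=\{u_0,\dots,u_t\}$ and $\mathcal{I}(s-t+2)=\{v_0,\dots,v_{s-t+1}\}$ be sets of nonnegative integers with $0=u_0<u_1<\dots<u_t$, $0=v_0<v_1<\dots<v_{s-t+1}$, and $1\notin\mathcal{I}(t+1)\cup\mathcal{I}(s-t+2)$. Put $$G_{i\{j,k\}}=(P^{\mathcal{A}}_{u_i}\star Q^{\mathcal{A}}_{v_j}\star L^{\mathcal{A}})\cap(P^{\mathcal{A}}_{u_i}\star Q^{\mathcal{A}}_{v_k}\star L^{\mathcal{A}}),\qquad G_{\{i,k\}j}=(P^{\mathcal{A}}_{u_i}\star Q^{\mathcal{A}}_{v_j}\star L^{\mathcal{A}})\cap(P^{\mathcal{A}}_{u_k}\star Q^{\mathcal{A}}_{v_j}\star L^{\mathcal{A}}).$$ Then the set consisting of the points $G_{i\{j,k\}}$ with $0\le j\le a_i-1$ and $a_i\le k\le s-t+1$, for $i=0,\dots,t$, together with the points $G_{\{i,k\}j}$ with $\min\{a_i,a_k\}\le j\le\max\{a_i,a_k\}-1$,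 for $0\le i<k\le t$, is a Gorenstein zeroscheme in $\mathbb{P}^3$ with $h$-vector $\mathbf{h}$.
   Context: We work over $\mathbb{C}$; $\mathbb{N}=\{0,1,2,\dots\}$. The Hadamard product of points $p=[p_0:\dots:p_n]$, $q=[q_0:\dots:q_n]$ of $\mathbb{P}^n$ is $p\star q=[p_0q_0:\dots:p_nq_n]$, defined when some $p_iq_i\ne 0$; for a point $p$ and a variety $Y$, $p\star Y$ is the Zariski closure of $\{p\star q: q\in Y,\ p\star q\text{ is defined}\}$. $\mathcal{W}=\{[1:-m],\,[1:-\tfrac1m] : m\in\mathbb{N},\ m\ge 1\}\subset\mathbb{P}^1$. Given $\mathcal{A}$, $L^{\mathcal{A}}\subset\mathbb{P}^3$ is the line $\sum_{s=0}^3\alpha_sx_s=0=\sum_{s=0}^3\beta_sx_s$, and for $k\in\mathbb{N}$ $$P^{\mathcal{A}}_k=\left[\tfrac{\alpha_0+k\beta_0}{\alpha_0}:\dots:\tfrac{\alpha_3+k\beta_3}{\alpha_3}\right],\quad Q^{\mathcal{A}}_k=\left[\tfrac{k\alpha_0+\beta_0}{\beta_0}:\dots:\tfrac{k\alpha_3+\beta_3}{\beta_3}\right].$$ For positive integers $n,i$ with $i$-binomial expansion $n=\binom{n_i}{i}+\binom{n_{i-1}}{i-1}+\dots+\binom{n_j}{j}$, $n_i>n_{i-1}>\dots>n_j\ge j\ge1$, put $n^{<i>}=\binom{n_i+1}{i+1}+\dots+\binom{n_j+1}{j+1}$ (and $0^{<i>}=0$); a finite sequence $(h_0,h_1,\dots)$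 of nonnegative integers is an O-sequence if $h_0=1$ and $h_{i+1}\le h_i^{<i>}$ for all $i\ge1$. A sequence $(1,h_1,\dots,h_{s-1},1)$ of nonnegative integers is an SI-sequence if $h_i=h_{s-i}$ for all $0\le i\le s$ and $(h_0,h_1-h_0,\dots,h_r-h_{r-1},0,\dots)$ is an O-sequence, where $r=\lfloor s/2\rfloor$. In the displayed form of $\mathbf{h}$, $t$ is an integer with $1\le t\le s/2$ such that $h_i=h_t$ for $t\le i\le s-t$. ''Gorenstein zeroscheme'' means a zero-dimensional arithmetically Gorenstein subscheme (here a reduced finite set of points). The $h$-vector of a set of points is the first difference of its Hilbert function. *)

(* Defs.v *)
From HB Require Import structures.
From mathcomp Require Import all_boot all_order all_algebra.
From mathcomp Require Import ring_quotient complex.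
From mathcomp Require Import boolp classical_sets functions cardinality reals.
From mathcomp Require Import mpoly.

Set Implicit Arguments.
Unset Strict Implicit.
Unset Printing Implicit Defensive.

Import Order.TTheory GRing.Theory Num.Theory.
Local Open Scope classical_set_scope.
Local Open Scope ring_scope.

Section CommutativeAlgebra.
Variable R : comNzRingType.

Definition is_ideal (J : set R) : Prop :=
  [/\ J 0, forall x y, J x -> J y -> J (x + y) & forall a x, J x -> J (a * x)].

Definition span_ideal (gens : seq R) : set R :=
  [set x | exists c : nat -> R, x = \sum_(i < size gens) c i * gens`_i].

Definition noetherian : Prop :=
  forall J : set R, is_ideal J -> exists gens, J = span_ideal gens.

Definition maximal_ideal (m : set R) : Prop :=
  [/\ is_ideal m, ~ m 1 &
      forall J : set R, is_ideal J -> ~ J 1 -> m `<=` J -> J = m].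

(* [psi] exhibits [B] as the localization of [R] at the prime ideal [m]; such
   a pair exists and is unique up to isomorphism. *)
Definition is_localization (m : set R) (B : comNzRingType)
    (psi : {rmorphism R -> B}) : Prop :=
  [/\ forall r, ~ m r -> exists b, psi r * b = 1,
      forall b, exists r w, ~ m w /\ b * psi w = psi r &
      forall r, psi r = 0 -> exists w, ~ m w /\ w * r = 0].

Definition injective_module (E : lmodType R) : Prop :=
  forall (M N : lmodType R) (i : {linear M -> N}) (f : {linear M -> E}),
    injective i -> exists g : {linear N -> E}, forall x, g (i x) = f x.

(* [R] has finite injective dimension as a module over itself: there is an
   exact sequence 0 -> R -> E_0 -> E_1 -> ... with every [E k] injective and
   [E k = 0] for large [k]. *)
Definition finite_injective_dimension : Prop :=
  exists (E : nat -> lmodType R) (eta : {linear R^o -> E 0%N})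
         (d : forall k, {linear E k -> E k.+1}),
    [/\ forall k, injective_module (E k),
        injective eta,
        forall x, d 0%N x = 0 <-> exists a, eta a = x,
        forall k x, d k.+1 x = 0 <-> exists y, d k y = x &
        exists n, forall k, (n < k)%N -> forall x : E k, x = 0].

End CommutativeAlgebra.

Definition gorenstein_ring (R : comNzRingType) : Prop :=
  noetherian R /\
  forall m : set R, maximal_ideal m ->
  forall (B : comNzRingType) (psi : {rmorphism R -> B}),
    is_localization m psi -> finite_injective_dimension B.

Section Projective.
Variables (K : fieldType) (n : nat).

(* Points of P^n are the lines through the origin of K^(n+1). *)
Record proj : Type :=
  Proj { line :> {vspace 'rV[K]_n.+1}; _ : \dim line == 1%N }.
HB.instance Definition _ := [isSub for line].
HB.instance Definition _ := [Choice of proj by <:].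

Fact proj_default_subproof : \dim <[const_mx 1 : 'rV[K]_n.+1]>%VS == 1%N.
Proof.
rewrite dim_vline eqb1; apply/eqP => /matrixP /(_ ord0 ord0) /eqP.
by rewrite !mxE oner_eq0.
Qed.
Definition proj_default : proj := Proj proj_default_subproof.

(* The point with homogeneous coordinates [x]; meaningful only for [x != 0]
   ([pt 0] is the arbitrary point [1 : ... : 1]). *)
Definition pt (x : 'rV[K]_n.+1) : proj := insubd proj_default <[x]>%VS.

Definition vanishes (f : {mpoly K[n.+1]}) (p : proj) : Prop :=
  forall x : 'rV[K]_n.+1, x \in line p -> f.@[x ord0] = 0.

Definition homogeneous (f : {mpoly K[n.+1]}) : Prop :=
  exists d, f \is d.-homog for mdeg.

Definition zero_locus (T : set {mpoly K[n.+1]}) : set proj :=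
  [set p | forall f, T f -> vanishes f p].

Definition zariski_closed (Z : set proj) : Prop :=
  exists2 T : set {mpoly K[n.+1]}, T `<=` homogeneous & Z = zero_locus T.

Definition zariski_closure (Y : set proj) : set proj :=
  smallest zariski_closed Y.

(* The Hadamard product of [p] and [q] is defined and equal to [r]. *)
Definition hadamard (p q r : proj) : Prop :=
  exists x y : 'rV[K]_n.+1,
    let xy := \row_i (x ord0 i * y ord0 i) in
    [/\ x \in line p, y \in line q, xy != 0 & r = pt xy].

Definition star (p : proj) (Y : set proj) : set proj :=
  zariski_closure [set r | exists2 q, Y q & hadamard p q r].

(* Since all homogeneous coordinates of the points of [X] are tested, for an
   infinite field this is the homogeneous ideal of [X]. *)
Definition ideal_of (X : set proj) : set {mpoly K[n.+1]} :=
  [set f | forall p, X p -> vanishes f p].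

Definition ideal_part (X : set proj) (d : nat) : {vspace dhomog n.+1 K d} :=
  xget 0%VS [set U : {vspace dhomog n.+1 K d} |
             forall f, f \in U <-> ideal_of X (mpoly_of_dhomog f)].

Definition hilbert_function (X : set proj) (d : nat) : nat :=
  (\dim {: dhomog n.+1 K d} - \dim (ideal_part X d))%N.

Definition h_vector (X : set proj) (d : nat) : int :=
  (hilbert_function X d)%:Z -
  (if d is e.+1 then hilbert_function X e else 0%N)%:Z.

Definition arithmetically_gorenstein (X : set proj) : Prop :=
  exists2 I : idealr {mpoly K[n.+1]},
    (forall f, f \in I <-> ideal_of X f) & gorenstein_ring {ideal_quot I}.

Definition gorenstein_zeroscheme (X : set proj) : Prop :=
  [/\ finite_set X, X !=set0 & arithmetically_gorenstein X].

End Projective.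

(* [ns = [:: n_i; n_(i-1); ...; n_j]] is the [i]-binomial expansion of [n];
   as [j = i - size ns + 1], sortedness of [rcons ns (i - size ns)] says that
   [n_i > ... > n_j >= j >= 1]. The empty sequence is allowed: it is an
   expansion exactly of [n = 0], which yields the convention 0^<i> = 0. *)
Definition binomial_expansion (i n : nat) (ns : seq nat) : Prop :=
  [/\ (size ns <= i)%N, sorted gtn (rcons ns (i - size ns)%N) &
      n = (\sum_(k < size ns) 'C(nth 0 ns k, i - k))%N].

Definition binomial_shift (i : nat) (ns : seq nat) : nat :=
  (\sum_(k < size ns) 'C((nth 0 ns k).+1, (i - k).+1))%N.

(* Finite sequences are continued by zeros. *)
Definition O_sequence (c : nat -> nat) : Prop :=
  c 0%N = 1%N /\
  forall i, (1 <= i)%N ->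
  forall ns, binomial_expansion i (c i) ns -> (c i.+1 <= binomial_shift i ns)%N.

(* The subtraction is truncated; it is only used where [h] is nondecreasing. *)
Definition difference (h : seq nat) (i : nat) : nat :=
  if i is j.+1 then (nth 0 h i - nth 0 h j)%N else nth 0%N h 0.

(* [h = [:: h_0; ...; h_s]]; the third clause is the nonnegativity of the
   differences. *)
Definition SI_sequence (h : seq nat) : Prop :=
  let s := (size h).-1 in
  let r := s./2 in
  [/\ nth 0%N h 0 = 1%N /\ nth 0%N h s = 1%N,
      forall i, (i <= s)%N -> nth 0%N h i = nth 0%N h (s - i),
      forall i, (i < r)%N -> (nth 0 h i <= nth 0 h i.+1)%N &
      O_sequence (fun i => if (i <= r)%N then difference h i else 0%N)].

Section Configuration.
Variable K : fieldType.

Definition pt1 (x y : K) : proj K 1 :=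
  pt (\row_(i < 2) if i == ord0 then x else y).

Definition W : set (proj K 1) :=
  [set p | exists2 m : nat, (1 <= m)%N &
           p = pt1 1 (- m%:R) \/ p = pt1 1 (- m%:R^-1)].

Variables alpha beta : 'I_4 -> K.

Definition L : set (proj K 3) :=
  [set p | forall x : 'rV[K]_4, x \in line p ->
     \sum_s alpha s * x ord0 s = 0 /\ \sum_s beta s * x ord0 s = 0].

Definition P (k : nat) : proj K 3 :=
  pt (\row_s ((alpha s + k%:R * beta s) / alpha s)).

Definition Q (k : nat) : proj K 3 :=
  pt (\row_s ((k%:R * alpha s + beta s) / beta s)).

Definition PQL (k l : nat) : set (proj K 3) := star (P k) (star (Q l) L).

Variables u v : nat -> nat.

(* [G1 i j k] is G_{i{j,k}} and [G2 i k j] is G_{{i,k}j}. *)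
Definition G1 (i j k : nat) : set (proj K 3) :=
  PQL (u i) (v j) `&` PQL (u i) (v k).

Definition G2 (i k j : nat) : set (proj K 3) :=
  PQL (u i) (v j) `&` PQL (u k) (v j).

End Configuration.

(* Main.v *)
(* Clearing scalars, [P_k * Q_l * L] is the intersection of the two planes
   [H_k : sum_s alpha_s beta_s x_s / (alpha_s + k beta_s) = 0] and
   [K_l : sum_s alpha_s beta_s x_s / (l alpha_s + beta_s) = 0], and all these planes
   osculate one twisted cubic, so that any four of them are independent.  The points
   of the theorem are the triple points lying on one line of the curve
   [C = union of the H_i cap K_j, j < a_i] and on one line of the residual curve
   inside the union of all the [H_i cap K_j].

   For a form [f] of degree [s - 1], the residues of [f / (product of the s + 3 planes)]
   sum to zero on every line of [C] and cancel at the nodes of [C]; this leaves a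
   relation [sum_p c_p f(p) = 0] over the points, with all [c_p <> 0].  Hence the
   spaces [V_d] of values of forms of degree [d] satisfy [V_d _|_ V_(s-1-d)] for the
   form with weights [c_p].  On the other hand, products of the planes give a triangular
   family of forms, [h_e] of them in degree [e], so [dim V_d >= h_0 + ... + h_d].
   By the symmetry of [h], both estimates are equalities.

   Let [z] be a linear form equal to [1] on suitable representatives of the points.
   The coordinate ring [A] embeds in [D^N] for [D = K[z]], and the equalities say that [A] is
   its own dual for the trace form [z^-s sum_p c_p a_p b_p].  With [F = K(z)] this
   identifies [F^N / A] with [Hom_D(A, F / D)], which is injective because [F / D] is
   divisible; localizing [0 -> A -> F^N -> F^N / A -> 0] gives injective resolutions of
   the local rings of [A]. *)
Require Import Defs.
From HB Require Import structures.
From mathcomp Require Import all_boot all_order all_algebra.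
From mathcomp Require Import ring_quotient complex.
From mathcomp Require Import boolp classical_sets functions cardinality reals.
From mathcomp Require Import mpoly.
From mathcomp Require Import ring zify.

Set Implicit Arguments.
Unset Strict Implicit.
Unset Printing Implicit Defensive.

Import Order.TTheory GRing.Theory Num.Theory.
Local Open Scope classical_set_scope.
Local Open Scope ring_scope.

(** * Baer's criterion and injective resolutions of length one *)

(** All planes share one parameter: dividing alpha + k beta by k + 1, and l alpha + beta by l + 1,
    gives members (1 - a) alpha + a beta of one pencil, with a = k/(k+1) and a = 1/(l+1). These
    values agree exactly when k l = 1, which excluding 1 from both index sets prevents; the value
    1/2 is thereby free too and supplies the plane [z] missing every point.

    The H_i are taken in the order of decreasing a_i, so that the lines of C form a Young diagram
    and the products of planes become triangular. The degrees match [h] because this diagram has a_d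
    boxes on its d-th diagonal: by Macaulay's bound a_d equals d + 1 up to the first d with a_d <=
    d, and decreases weakly from there on.

    [gorenstein_ring] tests every maximal ideal, also the inhomogeneous ones, and every model of the
    localization. The duality is therefore set up globally over D, and finite presentation of ideals
    carries it to a localization. Maps to F / D and F^N / A are represented by functions to F and
    F^N that are linear up to an error in D or A; a quotient module is formed only for the local
    resolution. *)

Definition linear_on (B : comNzRingType) (E : lmodType B) (J : set B)
    (phi : B -> E) : Prop :=
  (forall x y, J x -> J y -> phi (x + y) = phi x + phi y) /\
  (forall a x, J x -> phi (a * x) = a *: phi x).

Definition baer (B : comNzRingType) (E : lmodType B) : Prop :=
  forall (J : set B) (phi : B -> E), is_ideal J -> linear_on J phi ->
    exists e, forall x, J x -> phi x = x *: e.

Section Baer.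
Variables (B : comNzRingType) (E : lmodType B).

Section PartialMaps.
Variables (N : lmodType B).

(** A linear map on a submodule of N is encoded by its graph: extension becomes inclusion, as Zorn's
    lemma wants, and the domain needs no module structure of its own. *)
Definition partial_map (G : set (N * E)) : Prop :=
  [/\ forall a x y, G x -> G y -> G (a *: x.1 + y.1, a *: x.2 + y.2) &
      forall y, G (0, y) -> y = 0].

Lemma partial_map_inj G x y z :
  partial_map G -> G (x, y) -> G (x, z) -> y = z.
Proof.
move=> [GL G0] Gy Gz; apply/eqP; rewrite -subr_eq0; apply/eqP/G0.
have := GL (-1) _ _ Gz Gy; rewrite /= !scaleN1r addNr addrC.
by [].
Qed.

Hypothesis Ebaer : baer E.

(** The multipliers b with b x in the domain form an ideal, on which G induces a linear map; the [e]
    representing it by Baer's condition is a consistent value at x. *)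
Lemma partial_map_extend G x :
  partial_map G -> G (0, 0) ->
  exists G', [/\ partial_map G', G `<=` G' & exists y, G' (x, y)].
Proof.
move=> pG G0; have [GL G00] := pG.
pose J : set B := [set b | exists y, G (b *: x, y)].
have JI : is_ideal J; first split.
- by exists 0; rewrite scale0r.
- move=> a b [y Gy] [z Gz]; exists (y + z).
  by have := GL 1 _ _ Gy Gz; rewrite /= !scale1r -scalerDl.
- move=> a b [y Gy]; exists (a *: y).
  by have := GL a _ _ Gy G0; rewrite /= !addr0 scalerA.
pose phi (b : B) : E := xget 0 [set y | G (b *: x, y)].
have phiP b : J b -> G (b *: x, phi b).
  by move=> [y Gy]; apply: (@xgetPex _ 0 [set y | G (b *: x, y)]); exists y.
have phi_lin : linear_on J phi; first split.
- move=> a b Ja Jb; have [_ JD _] := JI.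
  apply: (partial_map_inj pG (phiP _ (JD _ _ Ja Jb)) _).
  by have := GL 1 _ _ (phiP _ Ja) (phiP _ Jb); rewrite /= !scale1r -scalerDl.
- move=> a b Jb; have [_ _ JM] := JI.
  apply: (partial_map_inj pG (phiP _ (JM a _ Jb)) _).
  by have := GL a _ _ (phiP _ Jb) G0; rewrite /= !addr0 scalerA.
have [e eP] := Ebaer JI phi_lin.
exists [set z | exists w b, G w /\ z = (w.1 + b *: x, w.2 + b *: e)]; split.
- split.
    move=> a _ _ [w [b [Gw ->]]] [w' [b' [Gw' ->]]].
    exists (a *: w.1 + w'.1, a *: w.2 + w'.2), (a * b + b'); split.
      exact: GL.
    rewrite /=; congr (_, _);
    by rewrite scalerDl -scalerA scalerDr addrACA.
  move=> y [w [b [Gw [/esym/eqP]]]]; rewrite addr_eq0 => /eqP w1 ->.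
  have Gb : G (b *: x, - w.2).
    have := GL (-1) _ _ Gw G0.
    by rewrite /= !addr0 !scaleN1r w1 opprK.
  have Jb : J b by exists (- w.2).
  by rewrite -eP // (partial_map_inj pG (phiP _ Jb) Gb) addrN.
- by move=> w Gw; exists w, 0; rewrite !scale0r !addr0; case: w Gw.
- by exists e, (0, 0), 1; rewrite /= !scale1r !add0r.
Qed.

End PartialMaps.

Lemma baer_injective : baer E -> injective_module E.
Proof.
move=> Ebaer M N i f inj_i.
have inj0 m : i m = 0 -> m = 0.
  by move=> im0; apply: inj_i; rewrite im0 linear0.
pose G0 : set (N * E) := [set (i m, f m) | m in [set: M]].
have pG0 : partial_map G0.
  split.
- move=> a _ _ [m _ <-] [m' _ <-]; exists (a *: m + m') => //.
  by rewrite !linearP.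
- by move=> y [m _ [/inj0 -> <-]]; rewrite linear0.
(* The empty chain has empty union, so containing [G0] is only required of nonempty graphs. A
   maximal graph cannot be empty, because [G0] itself is admissible. *)
pose P G := partial_map G /\ (G !=set0 -> G0 `<=` G).
have [F FP Ftot|G [[pG GG0] Gmax]] := @Zorn_bigcup _ P.
  split; first split.
  - move=> a x y [X FX Xx] [Y FY Yy].
    have [XY|YX] := Ftot _ _ FX FY.
      by exists Y => //; apply: (FP _ FY).1.1 => //; apply: XY.
    by exists X => //; apply: (FP _ FX).1.1 => //; apply: YX.
  - by move=> y [X FX]; apply: (FP _ FX).1.2.
  move=> [x [X FX Xx]]; apply: subset_trans (bigcup_sup FX).
  by apply: (FP _ FX).2; exists x.
have {}GG0 : G0 `<=` G.
  have [/GG0//|/set0P/negP/negPn/eqP G_0] := pselect (G !=set0).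
  exfalso; apply: (Gmax G0); last by split=> // _ .
  rewrite G_0; split; first exact: sub0set.
  by move=> /(_ (i 0, f 0)); apply; exists 0.
have G00 : G (0, 0) by apply: GG0; exists 0; rewrite // !linear0.
have Gtot x : exists y, G (x, y).
  have [G' [pG' GG' [y Gy]]] := partial_map_extend Ebaer x pG G00.
  exists y; have [/(_ _ Gy)//|nGG] := pselect (G' `<=` G).
  exfalso; apply: (Gmax G'); split=> // _.
  by apply: subset_trans GG'.
have [g gP] := choice Gtot.
have g_lin : linear g.
  move=> a x y; apply: (partial_map_inj pG (gP _) _).
  exact: (pG.1 a _ _ (gP x) (gP y)).
pose gl := GRing.isLinear.Build _ _ _ _ g g_lin.
pose g' : {linear N -> E} := HB.pack g gl.
exists g' => x; apply: (partial_map_inj pG (gP _) _).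
by apply: GG0; exists x.
Qed.

End Baer.

Local Open Scope quotient_scope.

(** * Quotient modules *)

Section QuotientModule.
Variables (B : comNzRingType) (E : lmodType B) (S : zmodClosed E).
Hypothesis S_scale : forall a, {in S, forall x, a *: x \in S}.

(** The closure proof is an argument of the type so that the module structure can be inferred from
    the type alone. *)
Definition quotmod of (forall a, {in S, forall x, a *: x \in S}) := Quotient.quot S.
Local Notation lmod_quot := (quotmod S_scale).

HB.instance Definition _ := GRing.Zmodule.on lmod_quot.

Lemma lmod_quot_eq (x y : E) :
  (\pi_lmod_quot x == \pi_lmod_quot y) = (x - y \in S).
Proof. by rewrite Quotient.idealrBE. Qed.

Lemma lmod_quotP (x : lmod_quot) : exists y, x = \pi_lmod_quot y.
Proof. by exists (repr x); rewrite reprK. Qed.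

Definition quot_scale (a : B) (x : lmod_quot) : lmod_quot :=
  \pi_lmod_quot (a *: repr x).

Lemma quot_scaleE a (x : E) :
  quot_scale a (\pi_lmod_quot x) = \pi_lmod_quot (a *: x).
Proof.
apply/eqP; rewrite lmod_quot_eq -scalerBr S_scale // -lmod_quot_eq.
by rewrite reprK.
Qed.

Lemma pi_lmod_quotD (x y : E) :
  \pi_lmod_quot (x + y) = \pi_lmod_quot x + \pi_lmod_quot y.
Proof. exact: (raddfD (\pi_(Quotient.quot S))). Qed.

Fact quot_scaleA a b x : quot_scale a (quot_scale b x) = quot_scale (a * b) x.
Proof.
by have [y ->] := lmod_quotP x; rewrite !quot_scaleE scalerA.
Qed.

Fact quot_scale1 : left_id 1 quot_scale.
Proof. by move=> x; have [y ->] := lmod_quotP x; rewrite quot_scaleE scale1r. Qed.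

Fact quot_scaleDr : right_distributive quot_scale +%R.
Proof.
move=> a x y; have [x' ->] := lmod_quotP x; have [y' ->] := lmod_quotP y.
by rewrite -pi_lmod_quotD !quot_scaleE scalerDr pi_lmod_quotD.
Qed.

Fact quot_scaleDl x : {morph quot_scale^~ x : a b / a + b}.
Proof.
move=> a b; have [y ->] := lmod_quotP x.
by rewrite !quot_scaleE scalerDl pi_lmod_quotD.
Qed.

HB.instance Definition _ := GRing.Zmodule_isLmodule.Build B lmod_quot
  quot_scaleA quot_scale1 quot_scaleDr quot_scaleDl.

Definition lmod_pi (x : E) : lmod_quot := \pi_lmod_quot x.

Fact lmod_pi_is_linear : linear lmod_pi.
Proof.
by move=> a x y; rewrite /lmod_pi pi_lmod_quotD -quot_scaleE.
Qed.
HB.instance Definition _ := GRing.isLinear.Build B E lmod_quot _ lmod_pi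
  lmod_pi_is_linear.

Lemma lmod_pi_eq0 x : lmod_pi x = 0 <-> x \in S.
Proof.
rewrite -(linear0 lmod_pi) /lmod_pi; split.
  by move=> /eqP; rewrite lmod_quot_eq subr0.
by move=> xS; apply/eqP; rewrite lmod_quot_eq subr0.
Qed.

Lemma lmod_pi_surj (y : lmod_quot) : exists x, lmod_pi x = y.
Proof. by exists (repr y); rewrite /lmod_pi reprK. Qed.

End QuotientModule.

(** * Submodules of free modules over a principal ideal ring *)

Definition pid (D : comNzRingType) : Prop :=
  forall I : set D, is_ideal I ->
    exists2 p, I p & forall x, I x -> exists q, x = q * p.

Definition is_submodule (D : comNzRingType) (V : lmodType D) (M : set V) : Prop :=
  M 0 /\ forall a x y, M x -> M y -> M (a *: x + y).

Section SubmodulesOfFreeModules.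
Variable D : comNzRingType.
Hypothesis pidD : pid D.

Definition tail_submodule n (M : set 'rV[D]_(1 + n)) : set 'rV[D]_n :=
  [set y | M (row_mx 0 y)].

Lemma is_submodule_tail n (M : set 'rV[D]_(1 + n)) :
  is_submodule M -> is_submodule (tail_submodule M).
Proof.
move=> [M0 ML]; split; first by rewrite /tail_submodule /= row_mx0.
move=> a x y Mx My; rewrite /tail_submodule /=.
have := ML a _ _ Mx My; rewrite scale_row_mx add_row_mx.
by rewrite scaler0 add0r.
Qed.

(** The first coordinates of M form an ideal; [m] lifts a generator, and subtracting a multiple of
    [m] clears the first coordinate. *)
Lemma submodule_step n (M : set 'rV[D]_(1 + n)) : is_submodule M ->
  exists2 m, M m & forall x, M x ->
    exists q, exists2 y, tail_submodule M y & x = q *: m + row_mx 0 y.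
Proof.
move=> [M0 ML]; pose I : set D := [set d | exists2 x, M x & x 0 0 = d].
have [] := @pidD I.
- split; first by exists 0 => //; rewrite mxE.
    move=> _ _ [x Mx <-] [y My <-]; exists (1 *: x + y); first exact: ML.
    by rewrite !mxE mul1r.
  move=> a _ [x Mx <-]; exists (a *: x + 0); first exact: ML.
  by rewrite !mxE addr0.
move=> _ [m Mm <-] mP; exists m => // x Mx.
have [|q xq] := mP (x 0 0); first by exists x.
have x_m : x - q *: m = row_mx 0 (rsubmx (x - q *: m)).
  rewrite -[LHS]hsubmxK; congr row_mx; apply/rowP => i.
  have i0 : lshift n i = 0 :> 'I_(1 + n) by apply/val_inj; rewrite /= ord1.
  by rewrite !mxE i0 xq mulrC subrr.
exists q, (rsubmx (x - q *: m)); last by rewrite -x_m addrC subrK.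
rewrite /tail_submodule /= -x_m addrC.
by rewrite -scaleNr; apply: ML.
Qed.

Lemma submodule_fg n (M : set 'rV[D]_n) : is_submodule M ->
  exists2 gens : seq 'rV[D]_n, (forall g, g \in gens -> M g) &
    forall x, M x -> exists c : nat -> D,
      x = \sum_(i < size gens) c i *: gens`_i.
Proof.
elim: n M => [|n IHn] M subM.
  exists [::] => // x _; exists (fun=> 0).
  by rewrite big_ord0; apply: thinmx0.
have [m Mm mP] := submodule_step subM.
have [gens gensM gensP] := IHn _ (is_submodule_tail subM).
exists (m :: [seq row_mx 0 g | g <- gens]).
  move=> g; rewrite inE => /orP[/eqP-> //|/mapP[g' /gensM gM ->]].
  exact: gM.
move=> x /mP[q [y /gensP[c ->] ->]].
exists (fun i => if i is i'.+1 then c i' else q).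
rewrite /= big_ord_recl /= size_map; congr (_ + _).
pose f : 'rV[D]_n -> 'rV[D]_(1 + n) := row_mx (0 : 'rV_1).
have fD : {morph f : x y / x + y}.
  by move=> u v; rewrite /f add_row_mx addr0.
have fZ a u : f (a *: u) = a *: f u.
  by rewrite /f (@scale_row_mx _ 1 1 n) scaler0.
have f0 : f 0 = 0 by rewrite /f row_mx0.
rewrite -[LHS]/(f _) (big_morph _ fD f0); apply: eq_bigr => i _.
rewrite /lift /= (nth_map 0) ?ltn_ord // add0n; exact: fZ.
Qed.

Variables (F : fieldType) (tof : {rmorphism D -> F}).

(** This is vanishing in F / D: maps to F / D are represented by functions to F whose defects of
    linearity are [integral]. *)
Definition integral (x : F) : Prop := exists d, x = tof d.

Lemma integral0 : integral 0.
Proof. by exists 0; rewrite rmorph0. Qed.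

Lemma integralD x y : integral x -> integral y -> integral (x + y).
Proof. by move=> [a ->] [b ->]; exists (a + b); rewrite rmorphD. Qed.

Lemma integralN x : integral x -> integral (- x).
Proof. by move=> [a ->]; exists (- a); rewrite rmorphN. Qed.

Lemma integralM x y : integral x -> integral y -> integral (x * y).
Proof. by move=> [a ->] [b ->]; exists (a * b); rewrite rmorphM. Qed.

(* [F / D] is divisible, hence injective over the principal ring [D]: maps to
   it extend from submodules of the free module. *)
Lemma submodule_functional n (M : set 'rV[D]_n) (g : 'rV[D]_n -> F) :
  is_submodule M ->
  (forall x y, M x -> M y -> integral (g (x + y) - (g x + g y))) ->
  (forall a x, M x -> integral (g (a *: x) - tof a * g x)) ->
  (forall d, tof d = 0 -> d = 0) ->
  exists y : 'I_n -> F, forall x, M x ->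
    integral (\sum_i tof (x 0 i) * y i - g x).
Proof.
move=> + + + inj_tof.
elim: n M g => [|n IHn]; last rewrite -[n.+1]/(1 + n)%N;
  move=> M g subM gD gZ.
  exists (fun=> 0) => x Mx; rewrite big_ord0.
  have := gZ 0 _ Mx; rewrite scale0r rmorph0 mul0r subr0.
  by rewrite [x]thinmx0 sub0r => /integralN.
have [m Mm mP] := submodule_step subM.
have subT := is_submodule_tail subM.
have [||y yP] := IHn _ (fun x => g (row_mx (0 : 'rV_1) x)) subT.
- move=> u v Mu Mv; have := gD _ _ Mu Mv.
  by rewrite add_row_mx addr0.
- move=> a u Mu; have := gZ a _ Mu.
  by rewrite scale_row_mx scaler0.
pose s (x : 'rV[D]_(1 + n)) := \sum_i tof (x 0 (rshift 1 i)) * y i.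
(* This solves the equation at [m] by division in F. If the first coordinate of [m] is zero, [y0]
   drops out, and [m] lies in the tail, where the induction hypothesis already covers it. *)
pose y0 := (g m - s m) / tof (m 0 0).
pose y' : 'rV_(1 + n) := row_mx (y0%:M) (\row_i y i).
exists (y' 0).
have sumE (x : 'rV_(1 + n)) : \sum_i tof (x 0 i) * y' 0 i =
    tof (x 0 0) * y0 + s x.
  rewrite big_split_ord big_ord1 row_mxEl mxE eqxx mulr1n; congr (_ * _ + _).
    by congr (tof (x 0 _)); apply/val_inj.
  by apply: eq_bigr => i _; rewrite row_mxEr mxE.
have sL q u (v : 'rV_n) :
    s (q *: u + row_mx 0 v) = tof q * s u + \sum_i tof (v 0 i) * y i.
  rewrite /s mulr_sumr -big_split; apply: eq_bigr => i _.
  by rewrite mxE [X in X + _]mxE row_mxEr rmorphD rmorphM /= mulrDl mulrA.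
have int_m : integral (tof (m 0 0) * y0 + s m - g m).
  have [m0|m0] := eqVneq (tof (m 0 0)) 0; last first.
    by rewrite /y0 mulrC divfK // subrK subrr; apply: integral0.
  have mE : m = row_mx 0 (rsubmx m).
    rewrite -[LHS]hsubmxK; congr row_mx; apply/rowP => i.
    have i0 : lshift n i = 0 :> 'I_(1 + n) by apply/val_inj; rewrite /= ord1.
    by rewrite !mxE i0 (inj_tof _ m0).
  have Tm : tail_submodule M (rsubmx m) by rewrite /tail_submodule /= -mE.
  have := yP _ Tm; rewrite -mE m0 mul0r add0r /s.
  by under eq_bigr do rewrite mxE.
move=> x Mx; have [q [u Tu xE]] := mP _ Mx.
rewrite sumE.
have Mqm : M (q *: m) by have := subM.2 q _ _ Mm subM.1; rewrite addr0.
have := integralD (integralD (integralM (ex_intro _ q erefl) int_m) (yP _ Tu))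
  (integralD (integralN (gD _ _ Mqm Tu)) (integralN (gZ q _ Mm))).
congr (integral _); rewrite xE sL.
have -> : (q *: m + row_mx 0 u) 0 0 = q * m 0 0.
  have -> : (0 : 'I_(1 + n)) = lshift n 0 by apply/val_inj.
  by rewrite mxE row_mxEl !mxE addr0.
rewrite rmorphM /=.
by ring.
Qed.

End SubmodulesOfFreeModules.

(** * Short injective resolutions and products of fields *)

Section Resolution.
Variable B : comNzRingType.
Variables (E0 E1 : lmodType B) (eta : {linear B^o -> E0}) (pi : {linear E0 -> E1}).

Let res_mod (k : nat) : lmodType B :=
  match k with 0 => E0 | 1 => E1 | _ => 'rV[B]_0 end.

Let res_diff (k : nat) : {linear res_mod k -> res_mod k.+1} :=
  match k return {linear res_mod k -> res_mod k.+1} with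
  | 0 => pi | 1 => \0 | _ => \0
  end.

Lemma finite_injective_dimension_resolution :
  injective_module E0 -> injective_module E1 -> injective eta ->
  (forall x, pi x = 0 <-> exists b, eta b = x) -> (forall y, exists x, pi x = y) ->
  finite_injective_dimension B.
Proof.
move=> injE0 injE1 eta_inj ker_pi pi_surj.
have rV0 (x : 'rV[B]_0) : x = 0 by apply: thinmx0.
exists res_mod, eta, res_diff; split=> //.
- case=> [|[|k]] //= M N i f i_inj.
  by exists \0 => x; rewrite [LHS]rV0 [RHS]rV0.
- case=> [|k] x /=.
    by split=> [_|_]; [have [y <-] := pi_surj x; exists y|rewrite [LHS]rV0].
  split=> [_|_]; last by case: k x.
  by exists 0; rewrite linear0; case: k x => [|k] x /=; rewrite [x]rV0.
- by exists 1%N; case=> [//|[//|k]] _ x /=; rewrite [x]rV0.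
Qed.

End Resolution.

Section ProductModule.
Variables (B : comNzRingType) (F : fieldType) (J : finType).
Variable chi : J -> {rmorphism B -> F}.

(** B acts on the factor i of F^J through [chi i]; [chi] is an argument so that the action can be
    read off the type. *)
Definition product_module of (J -> {rmorphism B -> F}) := {ffun J -> F}.
Local Notation Q := (product_module chi).
HB.instance Definition _ := GRing.Zmodule.on Q.

Definition product_scale (b : B) (x : Q) : Q := [ffun i => chi i b * x i].

Fact product_scaleA a b x :
  product_scale a (product_scale b x) = product_scale (a * b) x.
Proof. by apply/ffunP => i; rewrite !ffunE rmorphM mulrA. Qed.

Fact product_scale1 : left_id 1 product_scale.
Proof. by move=> x; apply/ffunP => i; rewrite !ffunE rmorph1 mul1r. Qed.

Fact product_scaleDr : right_distributive product_scale +%R.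
Proof. by move=> a x y; apply/ffunP => i; rewrite !ffunE mulrDr. Qed.

Fact product_scaleDl x : {morph product_scale^~ x : a b / a + b}.
Proof. by move=> a b; apply/ffunP => i; rewrite !ffunE rmorphD mulrDl. Qed.

HB.instance Definition _ := GRing.Zmodule_isLmodule.Build B Q
  product_scaleA product_scale1 product_scaleDr product_scaleDl.

Lemma product_scaleE b (x : Q) i : (b *: x) i = chi i b * x i.
Proof. by rewrite ffunE. Qed.

Definition product_eta (b : B^o) : Q := [ffun i => chi i b].

Fact product_eta_is_linear : linear product_eta.
Proof.
move=> a x y; apply/ffunP => i.
by rewrite ffunE rmorphD rmorphM [RHS]ffunE product_scaleE !ffunE.
Qed.
HB.instance Definition _ := GRing.isLinear.Build B B^o Q _ product_eta
  product_eta_is_linear.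

Definition product_image : {pred Q} := fun x => `[< exists b, product_eta b = x >].

Fact product_image_closed : zmod_closed product_image.
Proof.
split; first by apply/asboolP; exists 0; rewrite linear0.
move=> _ _ /asboolP[b <-] /asboolP[b' <-]; apply/asboolP; exists (b - b').
by rewrite linearB.
Qed.
HB.instance Definition _ := GRing.isZmodClosed.Build Q product_image
  product_image_closed.

Fact product_image_scale a : {in product_image, forall x, a *: x \in product_image}.
Proof.
by move=> _ /asboolP[b <-]; apply/asboolP; exists (a *: b); rewrite linearZ.
Qed.

Definition product_quot := quotmod product_image_scale.

(* A component on which [J] vanishes is killed by [phi], since the separator of
   that component annihilates [J]. *)
Lemma baer_product : (forall b, (forall i, chi i b = 0) -> b = 0) ->
  (forall i, exists2 b, chi i b != 0 & forall k, k != i -> chi k b = 0) ->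
  baer Q.
Proof.
move=> chi_inj sep I phi [I0 ID IM] [phiD phiM].
have /choice[e eP] i : exists e, forall x, I x -> phi x i = chi i x * e.
  have [[y [Iy yi]]|nI] := pselect (exists y, I y /\ chi i y != 0).
    exists (phi y i / chi i y) => x Ix.
    (* Commutativity gives [chi i y * phi x i = chi i x * phi y i], so the ratio found at the single
       element y serves every x. *)
    have : phi (y * x) i = phi (x * y) i by rewrite mulrC.
    by rewrite !phiM // !product_scaleE mulrA => <-; rewrite mulrAC divff ?mul1r.
  have chi0 x : I x -> chi i x = 0.
    by move=> Ix; apply/eqP/negPn/negP => xi; apply: nI; exists x.
  exists 0 => x Ix; rewrite mulr0.
  have [b bi bk] := sep i.
  have bx : b * x = 0.
    apply: chi_inj => k; rewrite rmorphM.
    have [->|ki] := eqVneq k i; first by rewrite (chi0 x) // mulr0.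
    by rewrite bk // mul0r.
  have phi0 : phi 0 = 0 by rewrite -[0](mul0r 0) phiM // scale0r.
  have := phiM b x Ix; rewrite bx phi0 => /ffunP/(_ i)/esym.
  rewrite product_scaleE [RHS]ffunE => /eqP.
  by rewrite mulf_eq0 (negbTE bi) => /eqP.
exists (finfun e : Q) => x Ix; apply/ffunP => i.
by rewrite product_scaleE ffunE eP.
Qed.

End ProductModule.

(** * Orders with a perfect trace form over a principal ring *)

Lemma maximal_ideal_prime (A : comNzRingType) (m : set A) x y :
  maximal_ideal m -> ~ m x -> ~ m y -> ~ m (x * y).
Proof.
move=> [[m0 mD mM] m1 mmax] nmx nmy mxy; apply: nmy.
pose J : set A := [set z | exists u a, m u /\ z = u + a * x].
have JI : is_ideal J; first split.
- by exists 0, 0; rewrite mul0r addr0.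
- move=> _ _ [u [a [mu ->]]] [u' [a' [mu' ->]]].
  by exists (u + u'), (a + a'); rewrite mulrDl addrACA; split=> //; apply: mD.
- move=> b _ [u [a [mu ->]]]; exists (b * u), (b * a); split; first exact: mM.
  by rewrite mulrDr mulrA.
have mJ : m `<=` J by move=> u mu; exists u, 0; rewrite mul0r addr0.
have [[u [a [mu one]]]|nJ1] := pselect (J 1).
  rewrite -[y]mul1r one mulrDl -mulrA [u * y]mulrC.
  by apply: mD; apply: mM.
exfalso; apply: nmx; rewrite -(mmax _ JI nJ1 mJ).
by exists 0, 1; rewrite mul1r add0r.
Qed.

Section FrobeniusOrder.
Variables (D A : comNzRingType) (F : fieldType) (tof : {rmorphism D -> F}).
Variables (N : nat) (eps : 'I_N -> {rmorphism A -> D}) (iota : {rmorphism D -> A}).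
Variable c : 'I_N -> F.

Hypothesis pidD : pid D.
Hypothesis tof_inj : forall d, tof d = 0 -> d = 0.
Hypothesis eps_iota : forall i d, eps i (iota d) = d.
Hypothesis eps_inj : forall a, (forall i, eps i a = 0) -> a = 0.
Hypothesis c_neq0 : forall i, c i != 0.
Hypothesis c_denom : forall i, exists2 q, q != 0 & integral tof (c i * tof q).
Hypothesis trace_integral : forall a, integral tof (\sum_i c i * tof (eps i a)).

(** A is viewed as a D-lattice in F^N; [trace_integral] and [trace_dual] say that it is its own dual
    for the form with weights [c]. *)
Definition in_order (z : 'I_N -> F) : Prop := exists a, forall i, z i = tof (eps i a).

Hypothesis trace_dual : forall z,
  (forall a, integral tof (\sum_i c i * (tof (eps i a) * z i))) -> in_order z.

Lemma in_orderD z z' : in_order z -> in_order z' -> in_order (fun i => z i + z' i).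
Proof.
move=> [a az] [b bz]; exists (a + b) => i.
by rewrite az bz !rmorphD.
Qed.

Lemma in_orderM a z : in_order z -> in_order (fun i => tof (eps i a) * z i).
Proof. by move=> [b bz]; exists (a * b) => i; rewrite bz !rmorphM. Qed.

Lemma in_order_ext z z' : z =1 z' -> in_order z -> in_order z'.
Proof. by move=> zz' [a az]; exists a => i; rewrite -zz'. Qed.

(** If q clears the denominator of [c i], then q times the i-th idempotent of F^N pairs integrally
    with all of A, hence lies in A by duality. *)
Lemma order_separator i :
  exists2 a, eps i a != 0 & forall k, k != i -> eps k a = 0.
Proof.
have [q q0 int_q] := c_denom i.
have [a|a aP] := trace_dual (z := fun k => if k == i then tof q else 0).
  rewrite (bigD1 i) //= eqxx big1 => [|k /negbTE ->]; last by rewrite !mulr0.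
  rewrite addr0 mulrCA; apply: integralM int_q.
  by exists (eps i a).
exists a; last first.
  by move=> k /negbTE ki; apply: tof_inj; rewrite -aP ki.
by apply: contra_neq q0 => ai; apply: tof_inj; have := aP i; rewrite eqxx ai rmorph0.
Qed.

(** A^k embeds D-linearly in the free module D^(kN), and generators over D generate over A.
    Arbitrary k is allowed because modules of relations between generators of an ideal must be
    finitely generated too. *)
Lemma order_submodule_fg k (M : set 'rV[A]_k) : is_submodule M ->
  exists2 gens : seq 'rV[A]_k, (forall g, g \in gens -> M g) &
    forall x, M x -> exists a : nat -> A,
      x = \sum_(i < size gens) a i *: gens`_i.
Proof.
move=> [M0 ML].
pose rho (x : 'rV[A]_k) := mxvec (\matrix_(i, j) eps j (x 0 i)).
have rhoL d x y : rho (iota d *: x + y) = d *: rho x + rho y.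
  rewrite -linearP; congr mxvec; apply/matrixP => i j.
  by rewrite !mxE rmorphD rmorphM eps_iota.
have rho0 : rho 0 = 0.
  rewrite -[RHS](linear0 mxvec); congr mxvec; apply/matrixP => i j.
  by rewrite !mxE rmorph0.
have rho_inj x y : rho x = rho y -> x = y.
  move=> /(can_inj mxvecK)/matrixP xy; apply/rowP => i.
  apply/eqP; rewrite -subr_eq0; apply/eqP/eps_inj => j.
  by have := xy i j; rewrite !mxE rmorphB => ->; rewrite subrr.
have [|gens gensM gensP] := submodule_fg pidD (M := [set rho x | x in M]).
  split; first by exists 0.
  by move=> d _ _ [x Mx <-] [y My <-]; exists (iota d *: x + y) => //; apply: ML.
have [gens' gens'M gens'E] :
    exists2 gens', (forall g, g \in gens' -> M g) & gens = map rho gens'.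
  elim: gens gensM {gensP} => [|g gs IH] gM; first by exists [::].
  have [x Mx xg] : [set rho x | x in M] g by apply: gM; rewrite mem_head.
  have [gs' gs'M ->] := IH (fun g' gg => gM _ (mem_behead (s := g :: gs) gg)).
  exists (x :: gs'); last by rewrite /= xg.
  by move=> h; rewrite inE => /orP[/eqP->|/gs'M].
exists gens' => // x Mx.
have [|d xE] := gensP (rho x); first by exists x.
exists (iota \o d); apply: rho_inj; rewrite {}xE gens'E size_map.
have rhoD : {morph rho : x y / x + y}.
  by move=> u v; have := rhoL 1 u v; rewrite rmorph1 !scale1r.
rewrite (big_morph _ rhoD rho0); apply: eq_bigr => i _.
by rewrite (nth_map 0) //= -[iota _ *: _]addr0 rhoL rho0 addr0.
Qed.

Lemma order_noetherian : noetherian A.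
Proof.
move=> J [J0 JD JM]; pose M : set 'rV[A]_1 := [set x | J (x 0 0)].
have [|gens gensM gensP] := order_submodule_fg (M := M).
  split; rewrite /M /=; first by rewrite mxE.
  by move=> a x y Jx Jy; rewrite !mxE; apply: JD => //; apply: JM.
exists [seq g 0 0 | g : 'rV[A]_1 <- gens]; apply/seteqP; split=> x.
  move=> Jx; have [|a aE] := gensP (x%:M); first by rewrite /M /= mxE.
  exists a; rewrite size_map; have /matrixP/(_ 0 0) := aE.
  rewrite mxE eqxx mulr1n => ->; rewrite summxE; apply: eq_bigr => i _.
  by rewrite !mxE (nth_map 0).
move=> [a ->]; rewrite size_map; elim/big_ind: _ => // i _.
by apply: JM; rewrite (nth_map 0) //; apply: gensM; apply: mem_nth.
Qed.

(* Composing with the trace turns a map from an ideal to [F^N / A] into a map to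
   [F / D], which extends; trace duality turns the extension back. *)
Lemma order_quotient_baer (J : set A) (g : A -> 'I_N -> F) : is_ideal J ->
  (forall x y, J x -> J y -> in_order (fun i => g (x + y) i - (g x i + g y i))) ->
  (forall a x, J x -> in_order (fun i => g (a * x) i - tof (eps i a) * g x i)) ->
  exists z : 'I_N -> F, forall x, J x ->
    in_order (fun i => tof (eps i x) * z i - g x i).
Proof.
move=> [J0 JD JM] gD gM.
pose row x : 'rV[D]_N := \row_i eps i x.
have row_inj x y : row x = row y -> x = y.
  move=> /rowP xy; apply/eqP; rewrite -subr_eq0; apply/eqP/eps_inj => j.
  by have := xy j; rewrite !mxE rmorphB => ->; rewrite subrr.
pose unrow (r : 'rV[D]_N) : A := xget 0 [set x | row x = r].
have rowK x : unrow (row x) = x.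
  apply: row_inj.
  by apply: (@xgetPex _ 0 [set y | row y = row x]); exists x.
pose tr (z : 'I_N -> F) := \sum_i c i * z i.
have tr_int z : in_order z -> integral tof (tr z).
  move=> [a az]; have := trace_integral a; congr integral.
  by apply: eq_bigr => i _; rewrite az.
have trB z z' : tr z - tr z' = tr (fun i => z i - z' i).
  by rewrite /tr -sumrB; apply: eq_bigr => i _; rewrite mulrBr.
have trD z z' : tr z + tr z' = tr (fun i => z i + z' i).
  by rewrite /tr -big_split; apply: eq_bigr => i _; rewrite /= mulrDr.
have trM d z : tof d * tr z = tr (fun i => tof d * z i).
  by rewrite /tr mulr_sumr; apply: eq_bigr => i _; rewrite mulrCA.
have rowD x y : row x + row y = row (x + y).
  by apply/rowP => i; rewrite !mxE rmorphD.
have rowM d x : d *: row x = row (iota d * x).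
  by apply/rowP => i; rewrite !mxE rmorphM eps_iota.
have [|||y yP] := submodule_functional (M := [set row x | x in J])
    (g := fun r => tr (g (unrow r))) pidD _ _ _ tof_inj.
- split; first by exists 0 => //; apply/rowP => i; rewrite !mxE rmorph0.
  move=> a _ _ [x Jx <-] [x' Jx' <-]; exists (iota a * x + x').
    by apply: JD => //; apply: JM.
  by rewrite rowM rowD.
- move=> _ _ [x Jx <-] [x' Jx' <-]; rewrite rowD !rowK trD trB.
  by apply: tr_int; apply: gD.
- move=> d _ [x Jx <-]; rewrite rowM !rowK trM trB; apply: tr_int.
  by apply: in_order_ext (gM (iota d) _ Jx) => i; rewrite eps_iota.
(* [y] represents the functional for the standard pairing; dividing by [c i] passes to the trace
   pairing. Integrality at all multiples [a * x] is the premise of [trace_dual]. *)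
exists (fun i => y i / c i) => x Jx; apply: trace_dual => a.
have Jax : J (a * x) by apply: JM.
have := yP _ (ex_intro2 _ _ _ Jax erefl); rewrite rowK => int1.
have := integralD int1 (tr_int _ (gM a _ Jx)).
congr integral; rewrite /tr -sumrB -big_split; apply: eq_bigr => i _ /=.
rewrite mxE !rmorphM /=.
by field; rewrite c_neq0.
Qed.

End FrobeniusOrder.

(** * Localization at a maximal ideal *)

Section Localization.
Variables (D A : comNzRingType) (F : fieldType) (tof : {rmorphism D -> F}).
Variables (N : nat) (eps : 'I_N -> {rmorphism A -> D}) (iota : {rmorphism D -> A}).
Variable c : 'I_N -> F.

Hypothesis pidD : pid D.
Hypothesis tof_inj : forall d, tof d = 0 -> d = 0.
Hypothesis eps_iota : forall i d, eps i (iota d) = d.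
Hypothesis eps_inj : forall a, (forall i, eps i a = 0) -> a = 0.
Hypothesis c_neq0 : forall i, c i != 0.
Hypothesis c_denom : forall i, exists2 q, q != 0 & integral tof (c i * tof q).
Hypothesis trace_integral : forall a, integral tof (\sum_i c i * tof (eps i a)).
Hypothesis trace_dual : forall z,
  (forall a, integral tof (\sum_i c i * (tof (eps i a) * z i))) ->
  in_order tof eps z.

Variables (m : set A) (B : comNzRingType) (psi : {rmorphism A -> B}).
Hypothesis m_max : maximal_ideal m.
Hypothesis psi_loc : is_localization m psi.

Let m_prime x y : ~ m x -> ~ m y -> ~ m (x * y) := maximal_ideal_prime m_max.

Let m_proper : ~ m 1. Proof. by case: m_max. Qed.

(* The branches passing through the point [m]. *)
Definition branch : finType := {i : 'I_N | `[< forall a, eps i a = 0 -> m a >]}.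

Lemma branch_neq0 (i : branch) w : ~ m w -> tof (eps (val i) w) != 0.
Proof.
move=> mw; apply/eqP => /tof_inj w0; apply: mw.
by have /asboolP := valP i; apply.
Qed.

(** A branch not through m has an element outside m in the kernel of its [eps i]; the product of
    these stays outside m because m is prime. *)
Lemma branch_killer :
  exists2 w, ~ m w & forall i : 'I_N, ~~ `[< forall a, eps i a = 0 -> m a >] ->
    eps i w = 0.
Proof.
have killer (i : 'I_N) : exists w, ~ m w /\
    (~~ `[< forall a, eps i a = 0 -> m a >] -> eps i w = 0).
  case: asboolP => [_|]; first by exists 1.
  move=> /existsNP[w /not_implyP[w0 mw]]; by exists w.
have [w wP] := choice killer.
exists (\prod_i w i).
  by elim/big_ind: _ => // i _; case: (wP i).
move=> i ni; rewrite (bigD1 i) //= rmorphM.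
by case: (wP i) => _ ->; rewrite ?mul0r.
Qed.

Lemma fraction_exists b : exists rw : A * A, ~ m rw.2 /\ b * psi rw.2 = psi rw.1.
Proof. by have [_ /(_ b)[r [w [mw bE]]] _] := psi_loc; exists (r, w). Qed.

Lemma psi_eq x y : psi x = psi y -> exists2 w, ~ m w & w * x = w * y.
Proof.
move=> xy; have [_ _ /(_ (x - y))[|w [mw wxy]]] := psi_loc.
  by rewrite rmorphB xy subrr.
by exists w => //; apply/eqP; rewrite -subr_eq0 -mulrBr wxy.
Qed.

Section BranchMap.
Variable i : branch.

(** B is known only through [is_localization], so a fraction representing b is chosen. The choice is
    immaterial, since on a branch through m the elements outside m have nonzero images. *)
Definition branch_fun (b : B) : F :=
  let rw := xget (0, 1) [set rw : A * A | ~ m rw.2 /\ b * psi rw.2 = psi rw.1] in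
  tof (eps (val i) rw.1) / tof (eps (val i) rw.2).

Lemma branch_funE b r w : ~ m w -> b * psi w = psi r ->
  branch_fun b = tof (eps (val i) r) / tof (eps (val i) w).
Proof.
move=> mw bE; rewrite /branch_fun.
have := @xgetPex _ (0, 1) _ (fraction_exists b).
move: (xget _ _) => [r' w'] /= [mw' bE'].
have [|w'' mw'' w''E] := @psi_eq (r' * w) (r * w').
  by rewrite !rmorphM -bE -bE' mulrAC.
apply/eqP; rewrite eqr_div ?branch_neq0 //; apply/eqP.
rewrite -!rmorphM; apply: (mulfI (branch_neq0 i mw'')).
by rewrite -!rmorphM w''E.
Qed.

Fact branch_fun_zmod : zmod_morphism branch_fun.
Proof.
move=> x y; have [[r w] /= [mw xE]] := fraction_exists x.
have [[r' w'] /= [mw' yE]] := fraction_exists y.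
rewrite (branch_funE mw xE) (branch_funE mw' yE).
rewrite (@branch_funE (x - y) (r * w' - r' * w) (w * w')); last 2 first.
- exact: m_prime.
- rewrite rmorphB !rmorphM -xE -yE; ring.
rewrite !(rmorphM, rmorphB); field.
by rewrite !branch_neq0.
Qed.

Fact branch_fun_monoid : monoid_morphism branch_fun.
Proof.
split.
  by rewrite (@branch_funE 1 1 1) ?mul1r // !rmorph1 divr1.
move=> x y; have [[r w] /= [mw xE]] := fraction_exists x.
have [[r' w'] /= [mw' yE]] := fraction_exists y.
rewrite (branch_funE mw xE) (branch_funE mw' yE).
rewrite (@branch_funE (x * y) (r * r') (w * w')); last 2 first.
- exact: m_prime.
- rewrite !rmorphM -xE -yE; ring.
rewrite !rmorphM; field.
by rewrite !branch_neq0.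
Qed.

HB.instance Definition _ := GRing.isZmodMorphism.Build B F branch_fun branch_fun_zmod.
HB.instance Definition _ := GRing.isMonoidMorphism.Build B F branch_fun
  branch_fun_monoid.

Definition branch_map : {rmorphism B -> F} := branch_fun.

Lemma branch_map_psi a : branch_map (psi a) = tof (eps (val i) a).
Proof.
rewrite /= (@branch_funE (psi a) a 1) ?rmorph1 ?mulr1 ?divr1 //.
Qed.

End BranchMap.

Lemma branch_map_inj b : (forall i, branch_map i b = 0) -> b = 0.
Proof.
move=> b0; have [[r w] /= [mw bE]] := fraction_exists b.
have [k mk kP] := branch_killer.
(* The numerator vanishes on the branches through m, and [k] on all the others. *)
have kr : k * r = 0.
  apply: eps_inj => i; rewrite rmorphM.
  have [Pi|/kP->] := boolP `[< forall a, eps i a = 0 -> m a >]; last by rewrite mul0r.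
  have := b0 (exist _ i Pi); rewrite /= (branch_funE _ mw bE) => /eqP.
  rewrite mulf_eq0 invr_eq0 (negbTE (branch_neq0 (exist _ i Pi) mw)) orbF.
  by move=> /eqP/tof_inj /= ->; rewrite mulr0.
have [inv _ _] := psi_loc.
have [w' ww'] := inv _ mw; have [k' kk'] := inv _ mk.
have : psi k * psi r = 0 by rewrite -rmorphM kr rmorph0.
rewrite -bE => /(congr1 (fun x => x * k' * w')).
rewrite !mul0r => <-.
transitivity (b * (psi w * w') * (psi k * k')); last ring.
by rewrite ww' kk' !mulr1.
Qed.

Lemma branch_separator i :
  exists2 b, branch_map i b != 0 & forall k, k != i -> branch_map k b = 0.
Proof.
have [a ai ak] := order_separator tof_inj c_denom trace_dual (val i).
exists (psi a); rewrite ?branch_map_psi.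
  by apply: contra_neq ai => /tof_inj.
by move=> k ki; rewrite branch_map_psi ak ?rmorph0.
Qed.

Local Notation E0 := (product_module branch_map).
Local Notation E1 := (product_quot branch_map).

Definition restrict (z : 'I_N -> F) : E0 := [ffun i : branch => z (val i)].

(** The denominator of a fraction, times an element killing the branches away from m, carries all
    coordinates of z into A, also those that [restrict] forgets. *)
Lemma restrict_in_order z : restrict z \in product_image (chi := branch_map) ->
  exists2 w, ~ m w & in_order tof eps (fun i => tof (eps i w) * z i).
Proof.
move=> /asboolP[b /ffunP bz]; have [[r w] /= [mw bE]] := fraction_exists b.
have [k mk kP] := branch_killer.
exists (k * w); first exact: m_prime.
exists (k * r) => i; rewrite !rmorphM.
have [Pi|/kP->] := boolP `[< forall a, eps i a = 0 -> m a >]; last first.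
  by rewrite rmorph0 !mul0r.
have := bz (exist _ i Pi); rewrite !ffunE /= => <-.
rewrite (branch_funE _ mw bE) /=; field.
exact: (branch_neq0 (exist _ i Pi)).
Qed.

Lemma restrict_surj (e : E0) : exists z, restrict z = e.
Proof.
exists (fun i => if insub i is Some k then e k else 0).
by apply/ffunP => k; rewrite ffunE valK.
Qed.

Lemma restrictM a z : restrict (fun i => tof (eps i a) * z i) = psi a *: restrict z.
Proof. by apply/ffunP => i; rewrite product_scaleE !ffunE branch_map_psi. Qed.

Lemma restrict_order z : in_order tof eps z -> restrict z \in product_image (chi := branch_map).
Proof.
move=> [a az]; apply/asboolP; exists (psi a); apply/ffunP => i.
by rewrite [LHS]ffunE [RHS]ffunE az; apply: branch_map_psi.
Qed.

(** The preimage J of the ideal in A is finitely presented, so one multiple w of the given map, with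
    w outside m, lifts to a map from J to F^N / A, where [order_quotient_baer] applies. *)
Lemma baer_branch_quotient : baer E1.
Proof.
have Aext z z' : z =1 z' -> in_order tof eps z -> in_order tof eps z'.
  exact: in_order_ext.
have [inv _ _] := psi_loc.
move=> I phi [I0 ID IM] [phiD phiM].
have phi0 : phi 0 = 0 by rewrite -[0](mul0r 0) phiM // scale0r.
pose J : set A := [set a | I (psi a)].
have JI : is_ideal J.
  split; rewrite /J /=; first by rewrite rmorph0.
    by move=> x y Ix Iy; rewrite rmorphD; apply: ID.
  by move=> a x Ix; rewrite rmorphM; apply: IM.
have [J0 JD JM] := JI.
have [gens gensJ gensP] : exists2 gens : seq A, (forall g, g \in gens -> J g) &
    forall x, J x -> exists a : nat -> A, x = \sum_(i < size gens) a i * gens`_i.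
  have [gens JE] := order_noetherian pidD eps_iota eps_inj JI.
  exists gens; last by rewrite JE.
  move=> g /(nthP 0)[k kn <-]; rewrite JE; exists (fun i => (i == k)%:R).
  rewrite (bigD1 (Ordinal kn)) //= eqxx mul1r big1 ?addr0 // => i.
  by rewrite -val_eqE /= => /negbTE ->; rewrite mul0r.
pose n := size gens; pose comb (a : 'rV[A]_n) := \sum_i a 0 i * gens`_i.
have combL b a a' : comb (b *: a + a') = b * comb a + comb a'.
  rewrite /comb mulr_sumr -big_split; apply: eq_bigr => i _.
  by rewrite !mxE mulrDl mulrA.
have combJ a : J (comb a).
  by rewrite /comb; elim/big_ind: _ => // i _; apply: JM; apply/gensJ/mem_nth.
have /choice[z zP] : forall k, exists zk,
    lmod_pi (product_image_scale (chi := branch_map)) (restrict zk) =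
    phi (psi gens`_k).
  move=> k; have [e eE] := lmod_pi_surj (phi (psi gens`_k)).
  by have [zk zkE] := restrict_surj e; exists zk; rewrite zkE.
pose zcomb (a : 'rV[A]_n) (j : 'I_N) : F := \sum_i tof (eps j (a 0 i)) * z i j.
have zcombL b a a' j :
    zcomb (b *: a + a') j = tof (eps j b) * zcomb a j + zcomb a' j.
  rewrite /zcomb mulr_sumr -big_split; apply: eq_bigr => i _.
  by rewrite !mxE !(rmorphD, rmorphM) mulrDl mulrA.
have zcombE a :
    lmod_pi (product_image_scale (chi := branch_map)) (restrict (zcomb a)) =
    phi (psi (comb a)).
  rewrite /comb rmorph_sum.
  have -> : restrict (zcomb a) = \sum_i psi (a 0 i) *: restrict (z i).
    apply/ffunP => j; rewrite ffunE sum_ffunE; apply: eq_bigr => i _.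
    by rewrite product_scaleE ffunE branch_map_psi.
  rewrite linear_sum.
  have [_ ->] : I (\sum_i psi (a 0 i * gens`_i)) /\
      phi (\sum_i psi (a 0 i * gens`_i)) = \sum_i phi (psi (a 0 i * gens`_i)).
    apply: (big_ind2 (fun x y => I x /\ phi x = y)) => //.
      move=> x _ y _ [Ix <-] [Iy <-]; split; first exact: ID.
      by rewrite phiD.
    by move=> i _; split=> //; apply: (JM (a 0 i) gens`_i); apply/gensJ/mem_nth.
  apply: eq_bigr => i _; rewrite linearZ rmorphM phiM -?zP //.
  by apply: (gensJ gens`_i); apply: mem_nth.
have comb0 : comb 0 = 0 by rewrite /comb big1 // => i _; rewrite mxE mul0r.
have zcomb0 j : zcomb 0 j = 0.
  by rewrite /zcomb big1 // => i _; rewrite mxE !rmorph0 mul0r.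
have relsM : is_submodule [set a | comb a = 0].
  by split=> //= b a a' a0 a'0; rewrite combL a0 a'0 mulr0 add0r.
have [rels relsR relsP] := order_submodule_fg pidD eps_iota eps_inj relsM.
(* Each relation between the generators forces the lifted values to combine to an element of the
   localization. Finitely many relations generate all of them, so one denominator suffices. *)
have [w mw wP] : exists2 w, ~ m w & forall a, comb a = 0 ->
    in_order tof eps (fun j => tof (eps j w) * zcomb a j).
  suff [w mw wP] : exists2 w, ~ m w & forall a, a \in rels ->
      in_order tof eps (fun j => tof (eps j w) * zcomb a j).
    exists w => // _ /relsP[b ->].
    have : forall i : 'I_(size rels), rels`_i \in rels by move=> i; apply: mem_nth.
    elim/big_ind: _ => [_|x y IHx IHy relsI|i _ relsI].
    - by exists 0 => j; rewrite zcomb0 mulr0 !rmorph0.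
    - apply: Aext (in_orderD (IHx relsI) (IHy relsI)) => j.
      by rewrite -mulrDr; congr (_ * _); have := zcombL 1 x y j;
        rewrite scale1r !rmorph1 mul1r => ->.
    - apply: Aext (in_orderM (b i) (wP _ (relsI i))) => j.
      by have := zcombL (b i) rels`_i 0 j; rewrite addr0 zcomb0 addr0 mulrCA => ->.
  elim: rels relsR {relsP} => [|a rels IH] relsR; first by exists 1.
  have [w mw wP] := IH (fun a' a'r => relsR _ (mem_behead (s := a :: rels) a'r)).
  have [|w' mw' w'P] := @restrict_in_order (zcomb a).
    apply/(lmod_pi_eq0 (product_image_scale (chi := branch_map))).
    rewrite zcombE.
    by rewrite (relsR a (mem_head _ _)) rmorph0 phi0.
  exists (w * w'); first exact: m_prime.
  move=> a'; rewrite inE => /orP[/eqP->|/wP a'P].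
    by apply: Aext (in_orderM w w'P) => j; rewrite !rmorphM mulrA.
  by apply: Aext (in_orderM w' a'P) => j; rewrite mulrC [w * w']mulrC !rmorphM; ring.
have coord x : exists a, J x -> x = comb a.
  have [Jx|nJx] := pselect (J x); last by exists 0.
  have [a aE] := gensP _ Jx; exists (\row_i a i) => _.
  by rewrite [LHS]aE; apply: eq_bigr => i _; rewrite mxE.
have [co coP] := choice coord.
(* The chosen coordinates [co x] are not linear in x, but their defects are relations, so by [wP]
   the defects of [g] lie in A. *)
pose g x j := tof (eps j w) * zcomb (co x) j.
have [||y yP] := order_quotient_baer pidD tof_inj eps_iota eps_inj c_neq0
    trace_integral trace_dual (J := J) (g := g) JI.
- move=> x x' Jx Jx'.
  have rel : comb (co (x + x') - (co x + co x')) = 0.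
    have := combL 1 (co x) (co x'); rewrite scale1r mul1r => combD.
    have := combL (-1) (co x + co x') (co (x + x')); rewrite scaleN1r addrC => ->.
    by rewrite combD -!coP //; [ring|apply: JD].
  apply: Aext (wP _ rel) => j; rewrite /g.
  have := zcombL (-1) (co x + co x') (co (x + x')) j; rewrite scaleN1r addrC => ->.
  have := zcombL 1 (co x) (co x') j; rewrite scale1r => ->.
  rewrite !(rmorphN, rmorph1); ring.
- move=> a x Jx.
  have rel : comb (- a *: co x + co (a * x)) = 0.
    by rewrite combL -!coP //; [ring|apply: JM].
  apply: Aext (wP _ rel) => j; rewrite /g zcombL !rmorphN; ring.
have [w' ww'] := inv _ mw.
(* [g] lifts [psi w] times [phi]; the inverse [w'] of [psi w] removes that factor. *)
exists (w' *: lmod_pi (product_image_scale (chi := branch_map)) (restrict y)) => x Ix.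
have [[r v] /= [mv xE]] := fraction_exists x.
have Jr : J r by rewrite /J /= -xE mulrC; apply: IM.
have key : psi w *: phi (psi r) =
    psi r *: lmod_pi (product_image_scale (chi := branch_map)) (restrict y).
  rewrite {1}(coP r Jr) -zcombE -!linearZ -!restrictM.
  apply/eqP; rewrite eq_sym -subr_eq0 -linearB; apply/eqP.
  apply/(lmod_pi_eq0 (product_image_scale (chi := branch_map))).
  suff <- : restrict (fun j => tof (eps j r) * y j - g r j) =
      restrict (fun j => tof (eps j r) * y j) -
      restrict (fun j => tof (eps j w) * zcomb (co r) j).
    exact: restrict_order (yP _ Jr).
  by apply/ffunP => j; rewrite !ffunE.
have [v' vv'] := inv _ mv.
have xE' : x = (v' * psi r) by rewrite -xE mulrCA [v' * _]mulrC vv' mulr1.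
rewrite {1}xE' phiM // xE' scalerA -[v' * psi r * w']mulrA [psi r * w']mulrC.
rewrite mulrA -scalerA -key scalerA -[v' * w' * _]mulrA [w' * _]mulrC.
by rewrite ww' mulr1.
Qed.

Theorem localization_finite_injective_dimension : finite_injective_dimension B.
Proof.
apply: (@finite_injective_dimension_resolution _ E0 E1
  (@product_eta B F branch branch_map)
  (lmod_pi (product_image_scale (chi := branch_map)))).
- exact: baer_injective (baer_product branch_map_inj branch_separator).
- exact: baer_injective baer_branch_quotient.
- move=> x y /ffunP xy; apply/eqP; rewrite -subr_eq0; apply/eqP.
  apply: branch_map_inj => i; rewrite rmorphB.
  by have := xy i; rewrite !ffunE => ->; rewrite subrr.
- move=> x; rewrite lmod_pi_eq0; split; first by move=> /asboolP.
  by move=> ?; apply/asboolP.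
- exact: lmod_pi_surj.
Qed.

End Localization.

Lemma frobenius_order_gorenstein (D A : comNzRingType) (F : fieldType)
    (tof : {rmorphism D -> F}) (N : nat) (eps : 'I_N -> {rmorphism A -> D})
    (iota : {rmorphism D -> A}) (c : 'I_N -> F) :
  pid D -> (forall d, tof d = 0 -> d = 0) ->
  (forall i d, eps i (iota d) = d) ->
  (forall a, (forall i, eps i a = 0) -> a = 0) ->
  (forall i, c i != 0) ->
  (forall i, exists2 q, q != 0 & integral tof (c i * tof q)) ->
  (forall a, integral tof (\sum_i c i * tof (eps i a))) ->
  (forall z, (forall a, integral tof (\sum_i c i * (tof (eps i a) * z i))) ->
     in_order tof eps z) ->
  gorenstein_ring A.
Proof.
move=> pidD tof_inj eps_iota eps_inj c_neq0 c_denom tr_int tr_dual; split.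
  exact: order_noetherian eps_iota eps_inj.
move=> m m_max B psi psi_loc.
exact: (@localization_finite_injective_dimension D A F tof N eps iota c
  _ _ _ _ _ _ _ _ m B psi).
Qed.

Lemma poly_pid (K : fieldType) : pid {poly K}.
Proof.
move=> I [I0 ID IM].
have [[p [Ip p0]]|nI] := pselect (exists p, I p /\ p != 0); last first.
  exists 0 => // x Ix; exists 0; rewrite mulr0; apply/eqP/negPn/negP => x0.
  by apply: nI; exists x.
pose P k := `[< exists2 q, I q & q != 0 /\ size q = k >].
have exP : exists k, P k by exists (size p); apply/asboolP; exists p.
case: (ex_minnP exP) => k /asboolP[q Iq [q0 <-]] qmin.
exists q => // x Ix; exists (x %/ q); rewrite [LHS](divp_eq x q).
have [->|r0] := eqVneq (x %% q) 0; first by rewrite addr0.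
have Ir : I (x %% q).
  rewrite -[x %% q](addKr (x %/ q * q)) -divp_eq -mulNr.
  by apply: ID => //; apply: IM.
have /qmin : P (size (x %% q)) by apply/asboolP; exists (x %% q).
by rewrite leqNgt ltn_modp q0.
Qed.

(** * Orthogonality for a nondegenerate diagonal form *)

Section PerpendicularSpaces.
Variables (K : fieldType) (N : nat) (c : 'I_N -> K).
Hypothesis c_neq0 : forall i, c i != 0.
Implicit Types U V : {vspace 'rV[K]_N}.

Definition perp (U V : {vspace 'rV[K]_N}) : Prop := forall x y, x \in U -> y \in V ->
  \sum_i c i * (x 0 i * y 0 i) = 0.

Definition basis_matrix U : 'M[K]_(\dim U, N) := \matrix_(i < \dim U) (vbasis U)`_i.

Lemma basis_matrix_free U : row_free (basis_matrix U).
Proof.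
apply: inj_row_free => v vA; apply/rowP => i; rewrite mxE.
have /freeP fU := basis_free (vbasisP U).
apply: (fU (fun i => v 0 i)).
rewrite -[RHS]vA mulmx_sum_row; apply: eq_bigr => j _.
by rewrite rowK.
Qed.

Lemma perp_dim U V : perp U V -> (\dim U + \dim V <= N)%N.
Proof.
move=> UV; have /eqP <- := basis_matrix_free U.
have /eqP <- := basis_matrix_free V.
pose C := diag_mx (\row_i c i).
have Cu : C \in unitmx.
  rewrite unitmxE det_diag unitfE; apply/prodf_neq0 => i _.
  by rewrite mxE.
have -> : \rank (basis_matrix V) = \rank (C *m (basis_matrix V)^T).
  by rewrite eqmxMfull ?mxrank_tr // row_full_unit.
apply: mulmx0_rank_max; apply/matrixP => i j.
rewrite mxE [RHS]mxE.
rewrite -[RHS](UV (vbasis U)`_i (vbasis V)`_j) ?vbasis_mem ?mem_nth ?size_tuple //.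
apply: eq_bigr => k _; rewrite mul_diag_mx !mxE.
by ring.
Qed.

(** Adding y to U keeps it orthogonal to V, and [perp_dim] leaves no room for a larger space. *)
Lemma perp_mem U V (y : 'rV[K]_N) : perp U V -> (\dim U + \dim V)%N = N ->
  (forall x : 'rV_N, x \in V -> \sum_i c i * (y 0 i * x 0 i) = 0) -> y \in U.
Proof.
move=> UV dimUV yV.
have UyV : perp (U + <[y]>)%VS V.
  move=> _ x /memv_addP[u uU [_ /vlineP[k ->] ->]] xV.
  transitivity (\sum_i c i * (u 0 i * x 0 i) + k * \sum_i c i * (y 0 i * x 0 i)).
    rewrite mulr_sumr -big_split; apply: eq_bigr => i _ /=.
    by rewrite !mxE; ring.
  by rewrite yV // UV // mulr0 addr0.
have := perp_dim UyV; rewrite -[X in (_ <= X)%N]dimUV leq_add2r => dimU.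
have /eqP UE : U == (U + <[y]>)%VS by rewrite eqEdim addvSl.
by rewrite UE; apply: subvP (addvSr _ _) _ _; rewrite memv_line.
Qed.

(** In a vanishing combination, evaluate at the index of least key with a nonzero coefficient: all
    other terms vanish there. Ties between keys do no harm. *)
Lemma triangular_dim V (f : 'I_N -> 'rV[K]_N) (P : pred 'I_N) (key : 'I_N -> nat) :
  (forall i, P i -> f i \in V) -> (forall i, f i 0 i != 0) ->
  (forall i k, k != i -> (key k <= key i)%N -> f i 0 k = 0) ->
  (#|P| <= \dim V)%N.
Proof.
move=> fV fii fik.
pose X := [tuple f (enum_val a) | a < #|P|].
have XE (a : 'I_#|P|) : X`_a = f (enum_val a) by rewrite -tnth_nth tnth_mktuple.
have f_free : free X.
  apply/freeP => k sum0 a0; apply/eqP/negPn/negP => ka0.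
  case: (@arg_minnP _ a0 (fun a => k a != 0) (key \o enum_val) ka0) => a ka amin.
  have /matrixP/(_ 0 (enum_val a)) := sum0.
  rewrite summxE (bigD1 a) //= big1 ?addr0 => [|b ba].
    by rewrite XE !mxE => /eqP; rewrite mulf_eq0 (negbTE ka) (negbTE (fii _)).
  rewrite XE !mxE; have [->|kb] := eqVneq (k b) 0; first by rewrite mul0r.
  rewrite fik ?mulr0 //; last exact: amin.
  by rewrite (inj_eq enum_val_inj) eq_sym.
rewrite -[X in (X <= _)%N](size_tuple X).
move: f_free; rewrite /free => /eqP <-; apply: dimvS; apply/span_subvP => x.
move=> /tnthP[a ->]; rewrite tnth_mktuple; apply: fV.
exact: (enum_valP a).
Qed.

End PerpendicularSpaces.

(** * Coordinate rings of finite sets of points *)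

Section ProjectivePoints.
Variables (K : fieldType) (n : nat).
Implicit Types (x y : 'rV[K]_n.+1) (f : {mpoly K[n.+1]}).

Lemma line_pt x : x != 0 -> line (pt x) = <[x]>%VS.
Proof. by move=> x0; rewrite /pt insubdK // unfold_in dim_vline x0. Qed.

Lemma pt_line (q : proj K n) : exists2 x, x != 0 & q = pt x.
Proof.
case: q => U dU; have U0 : U != 0%VS by rewrite -dimv_eq0 (eqP dU).
exists (vpick U); first by rewrite vpick0.
apply/val_inj; rewrite /= line_pt ?vpick0 //; apply/eqP.
by rewrite eq_sym eqEdim -memvE memv_pick dim_vline vpick0 U0 (eqP dU).
Qed.

Lemma pt_scale a x : a != 0 -> pt (a *: x) = pt x.
Proof.
move=> a0; have [->|x0] := eqVneq x 0; first by rewrite scaler0.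
apply/val_inj; rewrite /= !line_pt ?scaler_eq0 ?negb_or ?a0 //.
apply/eqP; rewrite eqEdim -memvE memvZ ?memv_line //= !dim_vline.
by rewrite scaler_eq0 negb_or a0 x0.
Qed.

Lemma meval_scale_homog d f a x : f \is d.-homog for mdeg ->
  f.@[(a *: x) ord0] = a ^+ d * f.@[x ord0].
Proof.
move=> /dhomogP fd; rewrite !mevalE mulr_sumr big_seq_cond [RHS]big_seq_cond.
apply: eq_bigr => m; rewrite andbT => /fd/= md; rewrite mulrCA; congr (_ * _).
under eq_bigr do rewrite mxE exprMn.
by rewrite big_split /= prodrXr -[in RHS]md mdegE.
Qed.

(** The restriction of f to the line t -> t x: the coefficient of X^d is the value at x of the
    degree d part of f. These maps are the branches of the affine cone over the points. *)
Definition ray x f : {poly K} := mmap polyC (fun k => x ord0 k *: 'X) f.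

Lemma ray_is_zmod x : zmod_morphism (ray x).
Proof. by move=> f g; rewrite /ray rmorphB. Qed.
Lemma ray_is_monoid x : monoid_morphism (ray x).
Proof. by split=> [|f g]; rewrite /ray ?rmorph1 ?rmorphM. Qed.
HB.instance Definition _ x := GRing.isZmodMorphism.Build _ _ (ray x) (ray_is_zmod x).
HB.instance Definition _ x := GRing.isMonoidMorphism.Build _ _ (ray x) (ray_is_monoid x).

Lemma rayC x a : ray x a%:MP = a%:P.
Proof. by rewrite /ray mmapC. Qed.

Lemma horner_ray x f a : (ray x f).[a] = f.@[(a *: x) ord0].
Proof.
rewrite /ray /mmap horner_sum mevalE; apply: eq_bigr => m _.
rewrite hornerM hornerC /mmap1 horner_prod; congr (_ * _); apply: eq_bigr => i _.
by rewrite horner_exp hornerZ hornerX mxE mulrC.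
Qed.

Lemma ray_homog d x f : f \is d.-homog for mdeg -> ray x f = f.@[x ord0] *: 'X^d.
Proof.
move=> /dhomogP fd; rewrite mevalE /ray /mmap scaler_suml.
rewrite big_seq_cond [RHS]big_seq_cond.
apply: eq_bigr => m; rewrite andbT => /fd/= md; rewrite mul_polyC -scalerA; congr (_ *: _).
rewrite /mmap1; under [LHS]eq_bigr do rewrite -mul_polyC exprMn -rmorphXn.
by rewrite big_split /= prodrXr -rmorph_prod mul_polyC -md mdegE.
Qed.

Lemma coef_ray x f e : (ray x f)`_e = (pihomog mdeg e f).@[x ord0].
Proof.
rewrite [in LHS](pihomog_partitionE (mf := mdeg) (p := f) (leqnn _)).
rewrite rmorph_sum coef_sum.
transitivity (\sum_(d < mmeasure mdeg f) if d == e :> nat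
    then (pihomog mdeg e f).@[x ord0] else 0).
  apply: eq_bigr => d _; have /= -> := ray_homog x (pihomogP mdeg d f).
  rewrite coefZ coefXn eq_sym.
  by case: eqP => [->|_]; rewrite ?mulr1 ?mulr0.
have [le_e|lt_e] := leqP (mmeasure mdeg f) e.
  rewrite big1 => [|d _]; last by rewrite ltn_eqF // (leq_trans _ le_e).
  rewrite pihomogE big_seq_cond big1 ?meval0 // => m /andP[fm /eqP me].
  have := mmeasure_mnm_lt mdeg fm; rewrite me => /leq_trans/(_ le_e).
  by rewrite ltnn.
rewrite (bigD1 (Ordinal lt_e)) //= eqxx big1 ?addr0 // => d.
by rewrite -val_eqE /= => /negbTE ->.
Qed.

End ProjectivePoints.

Section EvaluationSpaces.
Variables (K : fieldType) (n N : nat) (p : 'I_N -> 'rV[K]_n.+1).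

Definition evaluation d (f : dhomog n.+1 K d) : 'rV[K]_N :=
  \row_i (mpoly_of_dhomog f).@[p i ord0].

Fact evaluation_is_linear d : linear (@evaluation d).
Proof.
move=> a f g; apply/rowP => i; rewrite !mxE.
have -> : mpoly_of_dhomog (a *: f + g) =
    a *: mpoly_of_dhomog f + mpoly_of_dhomog g by rewrite linearP.
by rewrite mevalD mevalZ.
Qed.
HB.instance Definition _ d := GRing.isLinear.Build K (dhomog n.+1 K d) 'rV[K]_N _
  (@evaluation d) (@evaluation_is_linear d).

Definition evaluation_space d : {vspace 'rV[K]_N} := limg (linfun (@evaluation d)).

Lemma evaluation_spaceP d (y : 'rV[K]_N) : reflect
  (exists2 f : {mpoly K[n.+1]}, f \is d.-homog for mdeg &
     y = \row_i f.@[p i ord0])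
  (y \in evaluation_space d).
Proof.
apply: (iffP memv_imgP) => [[f _ ->]|[f fd ->]].
  by exists (mpoly_of_dhomog f); rewrite ?dhomog_is_dhomog // lfunE.
by exists (DHomog fd); rewrite ?memvf // lfunE.
Qed.

Definition point_set : set (proj K n) := [set pt (p i) | i in [set: 'I_N]].

Hypothesis K_infinite : forall q : {poly K}, (forall a, q.[a] = 0) -> q = 0.
Hypothesis p_neq0 : forall i, p i != 0.

Lemma ideal_of_points f : ideal_of point_set f <-> forall i, ray (p i) f = 0.
Proof.
split=> [If i|f0 _ [i _ <-] x].
  apply: K_infinite => a; rewrite horner_ray; apply: (If (pt (p i))).
    by exists i.
  by rewrite line_pt // memvZ // memv_line.
by rewrite line_pt // => /vlineP[a ->]; rewrite -horner_ray f0 horner0.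
Qed.

Lemma ideal_of_points_homog d f : f \is d.-homog for mdeg ->
  ideal_of point_set f <-> forall i, f.@[p i ord0] = 0.
Proof.
move=> fd; rewrite ideal_of_points; split=> f0 i; have := f0 i.
  rewrite (ray_homog _ fd) => /eqP; rewrite scaler_eq0 expf_eq0 polyX_eq0 andbF orbF.
  by move/eqP.
by rewrite (ray_homog _ fd) => ->; rewrite scale0r.
Qed.

Lemma hilbert_function_points d :
  hilbert_function point_set d = \dim (evaluation_space d).
Proof.
have -> : hilbert_function point_set d =
    (\dim {: dhomog n.+1 K d} - \dim (lker (linfun (@evaluation d))))%N.
  congr (_ - \dim _)%N.
  have kerP f : f \in lker (linfun (@evaluation d)) <->
      ideal_of point_set (mpoly_of_dhomog f).
    rewrite memv_ker lfunE (ideal_of_points_homog (dhomog_is_dhomog f)).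
    split=> [/eqP/rowP f0 i|f0]; first by have := f0 i; rewrite !mxE.
    by apply/eqP/rowP => i; rewrite !mxE f0.
  rewrite /ideal_part; case: xgetP => [U _ UP|/(_ (lker (linfun (@evaluation d))))] //.
    by apply/vspaceP => f; apply/idP/idP => [/UP/kerP|/kerP/UP].
by rewrite -(limg_ker_dim (linfun (@evaluation d)) fullv) capfv addKn.
Qed.

End EvaluationSpaces.

Lemma dim_rV (K : fieldType) N : \dim {: 'rV[K]_N} = N.
Proof. by rewrite dimvf /dim /= mul1n. Qed.

(** * A Gorenstein criterion for finite sets of points *)

Section GorensteinPoints.
Variables (K : fieldType) (n N : nat) (p : 'I_N -> 'rV[K]_n.+1).
Variables (l : {mpoly K[n.+1]}) (s : nat) (c : 'I_N -> K).
Variables (f : 'I_N -> {mpoly K[n.+1]}) (deg key : 'I_N -> nat).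

Hypothesis K_infinite : forall q : {poly K}, (forall a, q.[a] = 0) -> q = 0.
Hypothesis N_gt0 : (0 < N)%N.
Hypothesis l_linear : l \is 1.-homog for mdeg.
Hypothesis l_one : forall i, l.@[p i ord0] = 1.
Hypothesis c_neq0 : forall i, c i != 0.
Hypothesis relation : forall g, g \is (s.-1).-homog for mdeg ->
  \sum_i c i * g.@[p i ord0] = 0.
Hypothesis f_homog : forall i, f i \is (deg i).-homog for mdeg.
Hypothesis f_diag : forall i, (f i).@[p i ord0] != 0.
Hypothesis f_triangular : forall i k, k != i -> (key k <= key i)%N ->
  (f i).@[p k ord0] = 0.
Hypothesis s_gt0 : (0 < s)%N.
Hypothesis deg_le : forall i, (deg i <= s)%N.
Hypothesis deg_sym : forall e, (e <= s)%N ->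
  #|[pred i | deg i == e]| = #|[pred i | deg i == (s - e)%N]|.

Local Notation V := (evaluation_space p).

Let point_neq0 i : p i != 0.
Proof.
apply/eqP => p0; have := l_one i.
have -> : p i = 0 *: p i by rewrite p0 scaler0.
by rewrite (meval_scale_homog _ _ l_linear) expr1 mul0r => /esym/eqP; rewrite oner_eq0.
Qed.

Lemma mul_power_l d e g : g \is d.-homog for mdeg -> (d <= e)%N ->
  exists2 g', g' \is e.-homog for mdeg & forall i, g'.@[p i ord0] = g.@[p i ord0].
Proof.
move=> gd de; exists (g * l ^+ (e - d)).
  have := dhomogM gd (dhomogMn (e - d) l_linear).
  by rewrite mul1n subnKC.
by move=> i; rewrite mevalM rmorphXn /= l_one expr1n mulr1.
Qed.

Lemma relation_le d g : g \is d.-homog for mdeg -> (d < s)%N ->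
  \sum_i c i * g.@[p i ord0] = 0.
Proof.
move=> gd ds; have [|g' g'd g'E] := mul_power_l (e := s.-1) gd.
  by rewrite -ltnS prednK.
by rewrite -[RHS](relation g'd); apply: eq_bigr => i _; rewrite g'E.
Qed.

Lemma evaluation_space_perp d : (d < s)%N -> perp c (V d) (V (s.-1 - d)).
Proof.
move=> ds _ _ /evaluation_spaceP[g gd ->] /evaluation_spaceP[g' g'd ->].
have sE : (d + (s.-1 - d) < s)%N by lia.
rewrite -[RHS](relation_le (dhomogM gd g'd) sE); apply: eq_bigr => i _.
by rewrite !mxE mevalM.
Qed.

Lemma count_le_dim d : (#|[pred i | (deg i <= d)%N]| <= \dim (V d))%N.
Proof.
pose h i : 'rV[K]_N := \row_k (f i).@[p k ord0].
apply: (@triangular_dim _ _ (V d) h _ key) => [i di|i|i k ki kk].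
- have [g gd gE] := mul_power_l (f_homog i) di.
  apply/evaluation_spaceP; exists g => //.
  by apply/rowP => k; rewrite !mxE gE.
- by rewrite mxE.
- by rewrite mxE f_triangular.
Qed.

Lemma card_deg (P : pred nat) :
  #|[pred i | P (deg i)]| = (\sum_(e < s.+1 | P e) #|[pred i | deg i == e]|)%N.
Proof.
rewrite -sum1_card (partition_big (fun i => inord (deg i) : 'I_s.+1) (fun e => P e)).
  apply: eq_bigr => e Pe; rewrite -sum1_card; apply: eq_bigl => i.
  rewrite !inE -val_eqE /= inordK ?ltnS ?deg_le //.
  by case: eqP => [->|_]; rewrite ?Pe ?andbT ?andbF.
by move=> i; rewrite inE inordK ?ltnS ?deg_le.
Qed.

(** Reflecting e to s - e turns the degrees at most s - 1 - d into the degrees above d. *)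
Lemma count_symmetric d : (d < s)%N ->
  (#|[pred i | (deg i <= d)%N]| + #|[pred i | (deg i <= s.-1 - d)%N]|)%N = N.
Proof.
move=> ds; rewrite (card_deg (fun e => (e <= s.-1 - d)%N)) (reindex_inj rev_ord_inj) /=.
rewrite (eq_bigr (fun e : 'I_s.+1 => #|[pred i | deg i == e]|)); last first.
  by move=> e _; rewrite subSS [RHS]deg_sym // -ltnS.
rewrite (eq_bigl (fun e : 'I_s.+1 => (d < e)%N)); last first.
  by move=> e; have := ltn_ord e; lia.
rewrite -(card_deg (fun e => (d < e)%N)).
rewrite -[RHS](card_ord N) -[RHS](cardC [pred i | (deg i <= d)%N]).
by congr (_ + _)%N; apply: eq_card => i; rewrite !inE ltnNge.
Qed.

Lemma count_full d : (s <= d)%N -> #|[pred i | (deg i <= d)%N]| = N.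
Proof.
move=> sd; rewrite -[RHS](card_ord N); apply: eq_card => i.
by rewrite !inE (leq_trans (deg_le i)).
Qed.

Lemma dim_evaluation_space d : \dim (V d) = #|[pred i | (deg i <= d)%N]|.
Proof.
apply/eqP; rewrite eqn_leq count_le_dim andbT.
have [ds|sd] := ltnP d s; last first.
  by rewrite count_full // -[X in (_ <= X)%N](dim_rV K) dimvS ?subvf.
have := perp_dim c_neq0 (evaluation_space_perp ds).
have := count_symmetric ds; have := count_le_dim (s.-1 - d); lia.
Qed.

Lemma evaluation_space_full d : (s <= d)%N -> V d = fullv.
Proof.
move=> sd; apply/eqP; rewrite eqEdim subvf dim_rV dim_evaluation_space.
by rewrite count_full /=.
Qed.

Lemma evaluation_space_dual d (y : 'rV[K]_N) : (d < s)%N ->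
  (forall g, g \is (s.-1 - d).-homog for mdeg ->
     \sum_i c i * (y 0 i * g.@[p i ord0]) = 0) ->
  y \in V d.
Proof.
move=> ds yg; apply: (perp_mem c_neq0 (evaluation_space_perp ds)).
  by rewrite !dim_evaluation_space count_symmetric.
move=> _ /evaluation_spaceP[g gd ->]; rewrite -[RHS](yg g gd).
by apply: eq_bigr => i _; rewrite mxE.
Qed.

Section CoordinateRing.
Variable I : idealr {mpoly K[n.+1]}.
Hypothesis IE : forall g, g \in I <-> ideal_of (point_set p) g.
Local Notation A := {ideal_quot I}.
Local Open Scope quotient_scope.

Definition branch_ray (i : 'I_N) (a : A) : {poly K} := ray (p i) (repr a).

Lemma branch_ray_pi i g : branch_ray i (\pi_A g) = ray (p i) g.
Proof.
apply/eqP; rewrite -subr_eq0 -rmorphB; apply/eqP.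
have : repr (\pi_A g) - g \in I by rewrite Quotient.idealrBE reprK.
by move=> /IE/ideal_of_points; apply.
Qed.

Lemma pi_surj (a : A) : exists g, a = \pi_A g.
Proof. by exists (repr a); rewrite reprK. Qed.

Fact branch_ray_zmod i : zmod_morphism (branch_ray i).
Proof.
move=> a b; have [g ->] := pi_surj a; have [g' ->] := pi_surj b.
by rewrite -rmorphB !branch_ray_pi rmorphB.
Qed.
Fact branch_ray_monoid i : monoid_morphism (branch_ray i).
Proof.
split; first by rewrite -(rmorph1 \pi_A) branch_ray_pi rmorph1.
move=> a b; have [g ->] := pi_surj a; have [g' ->] := pi_surj b.
by rewrite -rmorphM !branch_ray_pi rmorphM.
Qed.
HB.instance Definition _ i := GRing.isZmodMorphism.Build A {poly K} (branch_ray i)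
  (branch_ray_zmod i).
HB.instance Definition _ i := GRing.isMonoidMorphism.Build A {poly K} (branch_ray i)
  (branch_ray_monoid i).

Definition poly_to_ring (q : {poly K}) : A := \pi_A (map_poly (@mpolyC n.+1 K) q).[l].

Fact poly_to_ring_zmod : zmod_morphism poly_to_ring.
Proof. by move=> q q'; rewrite /poly_to_ring rmorphB hornerD hornerN rmorphB. Qed.
Fact poly_to_ring_monoid : monoid_morphism poly_to_ring.
Proof.
split=> [|q q']; rewrite /poly_to_ring.
  by rewrite rmorph1 hornerC rmorph1.
by rewrite rmorphM hornerM rmorphM.
Qed.
HB.instance Definition _ := GRing.isZmodMorphism.Build {poly K} A poly_to_ring
  poly_to_ring_zmod.
HB.instance Definition _ := GRing.isMonoidMorphism.Build {poly K} A poly_to_ring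
  poly_to_ring_monoid.

Lemma ray_poly_to_ring i q : branch_ray i (poly_to_ring q) = q.
Proof.
rewrite branch_ray_pi -horner_map /= (ray_homog _ l_linear) l_one scale1r expr1.
rewrite -map_poly_comp (eq_map_poly (g := polyC)); last by move=> a; apply: rayC.
by rewrite -[RHS]comp_polyXr.
Qed.

Lemma branch_ray_inj (a : A) : (forall i, branch_ray i a = 0) -> a = 0.
Proof.
have [g ->] := pi_surj a => g0; apply/eqP.
rewrite -(rmorph0 \pi_A) -Quotient.idealrBE subr0; apply/IE/ideal_of_points => // i.
by rewrite -branch_ray_pi.
Qed.

Local Notation tof := (@tofrac {poly K}).

Let weight i : {fraction {poly K}} := tof (c i)%:P / tof 'X^s.

Let Xs_neq0 : tof 'X^s != 0.
Proof. by rewrite tofrac_eq0 expf_neq0 ?polyX_eq0. Qed.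

Let coordinate_ring_trace a : integral tof (\sum_i weight i * tof (branch_ray i a)).
Proof.
have [g ->] := pi_surj a.
pose q := \sum_i c i *: ray (p i) g.
(* The coefficient of X^e is the relation applied to the degree e part of g and vanishes for e < s;
   so X^s divides [q] and cancels the denominator of [weight]. *)
have q_low : take_poly s q = 0.
  apply/polyP => e; rewrite coef_take_poly coef0; case: ltnP => // es.
  rewrite coef_sum -[RHS](relation_le (pihomogP mdeg e g) es).
  by apply: eq_bigr => i _; rewrite coefZ coef_ray.
exists (drop_poly s q); apply: (mulfI Xs_neq0).
have qE : q = drop_poly s q * 'X^s by rewrite -{1}(poly_take_drop s q) q_low add0r.
rewrite [RHS]mulrC -rmorphM -qE rmorph_sum mulr_sumr; apply: eq_bigr => i _.
by rewrite branch_ray_pi -mul_polyC rmorphM /weight mulrA [tof 'X^s * _]mulrC divfK.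
Qed.

Let coordinate_ring_dual z :
  (forall a, integral tof (\sum_i weight i * (tof (branch_ray i a) * z i))) ->
  in_order tof branch_ray z.
Proof.
move=> z_int.
(* In degree s some form g is 1 at one point and 0 at the others. Testing z against it leaves
   [c i * z i], as X^s cancels, so every coordinate is a polynomial. *)
have /choice[y zy] i : exists y, z i = tof y.
  have : delta_mx 0 i \in V s by rewrite evaluation_space_full ?memvf.
  move=> /evaluation_spaceP[g gd gE]; have [q] := z_int (\pi_A g).
  rewrite (bigD1 i) //= big1 => [|k ki]; rewrite branch_ray_pi (ray_homog _ gd).
    move/rowP/(_ i): gE; rewrite !mxE !eqxx => <-; rewrite scale1r addr0.
    rewrite /weight mulrA divfK // => qE; exists ((c i)^-1 *: q).
    rewrite -mul_polyC rmorphM /= -qE mulrA -rmorphM -rmorphM mulVf //.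
    by rewrite !rmorph1 mul1r.
  move/rowP/(_ k): gE; rewrite !mxE eqxx (negbTE ki) => <-.
  by rewrite scale0r rmorph0 mul0r mulr0.
have /choice[b bP] e : exists b, b \is e.-homog for mdeg /\
    forall i, b.@[p i ord0] = (y i)`_e.
  suff : \row_i (y i)`_e \in V e.
    move=> /evaluation_spaceP[b be /rowP bE]; exists b; split=> // i.
    by have := bE i; rewrite !mxE.
  have [se|es] := leqP s e; first by rewrite evaluation_space_full ?memvf.
  (* Against a form of degree s - 1 - e, divisibility by X^s kills the coefficient of X^(s-1), which
     is the pairing of g with the vector of coefficients of X^e. *)
  apply: evaluation_space_dual => // g gd.
  have [q qE] := z_int (\pi_A g).
  have {qE} : \sum_i c i *: (g.@[p i ord0] *: 'X^(s.-1 - e) * y i) = q * 'X^s.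
    apply/eqP; rewrite -subr_eq0 -(tofrac_eq0) rmorphB subr_eq0; apply/eqP.
    rewrite rmorphM /= -qE rmorph_sum mulr_suml; apply: eq_bigr => i _.
    rewrite branch_ray_pi (ray_homog _ gd) zy -!mul_polyC !rmorphM /weight.
    by rewrite [RHS]mulrAC divfK.
  move/polyP/(_ s.-1); rewrite coef_sum coefMXn ltn_predL s_gt0 => E.
  rewrite -[RHS]E.
  apply: eq_bigr => i _; rewrite coefZ -scalerAl coefZ coefXnM mxE.
  have -> : (s.-1 < s.-1 - e)%N = false by lia.
  have -> : (s.-1 - (s.-1 - e) = e)%N by lia.
  by ring.
pose M := \max_i size (y i).
exists (\pi_A (\sum_(e < M) b e)) => i; rewrite zy /= branch_ray_pi (rmorph_sum (ray (p i))).
apply: (congr1 tof); under eq_bigr => e _ do rewrite /= (ray_homog _ (bP e).1) (bP e).2.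
rewrite -poly_def; apply/polyP => k; rewrite coef_poly; case: ltnP => // Mk.
by rewrite nth_default // (leq_trans _ Mk) // leq_bigmax.
Qed.

Lemma coordinate_ring_gorenstein : gorenstein_ring A.
Proof.
apply: (@frobenius_order_gorenstein {poly K} A {fraction {poly K}} tof N branch_ray
  poly_to_ring weight).
- exact: poly_pid.
- by move=> q /eqP; rewrite tofrac_eq0 => /eqP.
- exact: ray_poly_to_ring.
- exact: branch_ray_inj.
- move=> i; apply: mulf_neq0; last by rewrite invr_eq0; exact: Xs_neq0.
  by rewrite tofrac_eq0 polyC_eq0.
- move=> i; exists 'X^s; first by rewrite expf_neq0 ?polyX_eq0.
  by rewrite /weight divfK //; exists (c i)%:P.
- exact: coordinate_ring_trace.
- exact: coordinate_ring_dual.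
Qed.

End CoordinateRing.

Lemma points_gorenstein_zeroscheme : gorenstein_zeroscheme (point_set p).
Proof.
split.
- exact: (finite_image _ finite_finset).
- by exists (pt (p (Ordinal N_gt0))); exists (Ordinal N_gt0).
pose P : {mpoly K[n.+1]} -> bool := fun g => `[< ideal_of (point_set p) g >].
have IP g := ideal_of_points K_infinite point_neq0 g.
have P_ideal : idealr_closed P.
  split; first by apply/asboolP/IP => i; rewrite rmorph0.
    apply/asboolP; move/IP/(_ (Ordinal N_gt0)).
    by rewrite rmorph1 => /eqP; rewrite oner_eq0.
  move=> a g g' /asboolP/IP g0 /asboolP/IP g'0; apply/asboolP/IP => i.
  by rewrite rmorphD rmorphM /= g0 g'0 mulr0 addr0.
pose I : idealr {mpoly K[n.+1]} := HB.pack P (isIdealr.Build _ P P_ideal).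
have IE g : g \in I <-> ideal_of (point_set p) g.
  by split=> [/asboolP//|Ig]; apply/asboolP.
by exists I => //; apply: coordinate_ring_gorenstein.
Qed.

Lemma points_h_vector d : h_vector (point_set p) d = #|[pred i | deg i == d]|%:Z.
Proof.
rewrite /h_vector !hilbert_function_points // dim_evaluation_space.
case: d => [|d]; first by rewrite subr0; congr Posz; apply: eq_card => i;
  rewrite !inE leqn0.
rewrite hilbert_function_points // dim_evaluation_space.
apply/eqP; rewrite subr_eq -PoszD eqz_nat; apply/eqP.
rewrite -(cardID [pred i | deg i == d.+1]).
by congr (_ + _)%N; apply: eq_card => i; rewrite !inE; lia.
Qed.

End GorensteinPoints.

(** * Residues and triple points of planes osculating a twisted cubic *)

(** Lagrange interpolation, compared in the top coefficient. It serves twice: as the residue theorem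
    on a line, where that coefficient is zero, and to evaluate a plane at a triple point. *)
Lemma divided_difference (K : fieldType) (T : finType) (theta : T -> K)
    (q : {poly K}) :
  injective theta -> (size q <= #|T|)%N ->
  \sum_c q.[theta c] / (\prod_(d | d != c) (theta c - theta d)) = q`_#|T|.-1.
Proof.
move=> theta_inj q_size.
pose D c := \prod_(d | d != c) (theta c - theta d).
pose basis c : {poly K} := \prod_(d | d != c) ('X - (theta d)%:P).
have D0 c : D c != 0.
  by apply/prodf_neq0 => d dc; rewrite subr_eq0 (inj_eq theta_inj) eq_sym.
have basis_diag c : (basis c).[theta c] = D c.
  by rewrite horner_prod; apply: eq_bigr => d _; rewrite !hornerE.
have basis_off c e : e != c -> (basis c).[theta e] = 0.
  by move=> ec; rewrite horner_prod (bigD1 e) //= !hornerE subrr mul0r.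
have basis_size c : size (basis c) = #|T|.
  rewrite /basis -big_filter size_prod_XsubC size_filter.
  have -> : count (fun d => d != c) (index_enum T) = #|[pred d | d != c]|.
    by rewrite -sum1_card -sum1_count.
  by rewrite [RHS](cardD1 c) inE /= add1n; congr _.+1; apply: eq_card => d; rewrite !inE andbT.
have qE : q = \sum_c (q.[theta c] / D c) *: basis c.
  apply/eqP; rewrite -subr_eq0; apply/negPn/negP => r0.
  have := max_poly_roots (rs := [seq theta c | c <- enum T]) r0.
  rewrite map_inj_uniq // enum_uniq size_map -cardE => /(_ _ isT).
  rewrite ltnNge (leq_trans (size_polyD _ _)) ?size_polyN; last first.
    rewrite geq_max q_size (leq_trans (size_sum _ _ _)) //.
    apply/bigmax_leqP => c _; rewrite (leq_trans (size_scale_leq _ _)) //.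
    by rewrite basis_size.
  move=> H; suff: false by []; apply: H.
  apply/allP => _ /mapP[e _ ->]; rewrite rootE hornerD hornerN horner_sum.
  rewrite (bigD1 e) //= big1 => [|c ce].
    by rewrite addr0 hornerZ basis_diag divfK // subrr.
  by rewrite hornerZ basis_off ?mulr0 // eq_sym.
have basis_monic c : (basis c)`_#|T|.-1 = 1.
  have /monicP := monic_prod_XsubC (index_enum T) (fun d => d != c) theta.
  by rewrite /lead_coef -/(basis c) basis_size.
rewrite [in RHS]qE coef_sum.
by apply: eq_bigr => c _; rewrite coefZ basis_monic mulr1.
Qed.

(* The residue theorem on each line of the curve, summed over the curve: residues
   at a point common to two lines of the curve cancel. *)
Lemma alternating_residue_sum (K : numFieldType) (m n : nat)
    (Phi : 'I_m + 'I_n -> 'I_m + 'I_n -> 'I_m + 'I_n -> K) (lam : 'I_m -> nat) :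
  (forall a b c, Phi a b c = - Phi a c b) ->
  (forall a b c, Phi a b c = - Phi c b a) ->
  (forall a b, \sum_c Phi a b c = 0) ->
  \sum_(i < m) \sum_(j < n | (j < lam i)%N)
    ((\sum_(k < m | (lam k <= j)%N) Phi (inl i) (inr j) (inl k)) +
     \sum_(l < n | (lam i <= l)%N) Phi (inl i) (inr j) (inr l)) = 0.
Proof.
move=> anti_r anti_l line_sum.
have eq_oppr0 (x : K) : x = - x -> x = 0.
  move=> /eqP; rewrite -subr_eq0 opprK -mulr2n => /eqP x0.
  by apply/eqP; move: x0 => /eqP; rewrite mulrn_eq0.
(* A node of the curve in one plane H_i is counted once from each of its two lines, with opposite
   signs; [int_l] is the same for the nodes in one plane K_j. *)
have int_r : \sum_(i < m) \sum_(j < n | (j < lam i)%N)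
    \sum_(l < n | (l < lam i)%N) Phi (inl i) (inr j) (inr l) = 0.
  rewrite big1 // => i _; apply: eq_oppr0.
  rewrite {1}exchange_big -sumrN; apply: eq_bigr => j _.
  by rewrite -sumrN; apply: eq_bigr => l _; rewrite anti_r.
have int_l : \sum_(i < m) \sum_(j < n | (j < lam i)%N)
    \sum_(k < m | (j < lam k)%N) Phi (inl i) (inr j) (inl k) = 0.
  rewrite (exchange_big_dep predT) //= big1 // => j _; apply: eq_oppr0.
  rewrite {1}exchange_big -sumrN; apply: eq_bigr => i _.
  by rewrite -sumrN; apply: eq_bigr => k _; rewrite anti_l.
suff E : \sum_(i < m) \sum_(j < n | (j < lam i)%N)
    ((\sum_(k < m | (lam k <= j)%N) Phi (inl i) (inr j) (inl k)) +
     \sum_(l < n | (lam i <= l)%N) Phi (inl i) (inr j) (inr l)) +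
    (\sum_(i < m) \sum_(j < n | (j < lam i)%N)
       (\sum_(k < m | (j < lam k)%N) Phi (inl i) (inr j) (inl k)) +
     \sum_(i < m) \sum_(j < n | (j < lam i)%N)
       (\sum_(l < n | (l < lam i)%N) Phi (inl i) (inr j) (inr l))) = 0.
  by move: E; rewrite int_l int_r !addr0.
rewrite -!big_split big1 // => i _.
rewrite -!big_split big1 //= => j ji.
rewrite -[RHS](line_sum (inl i) (inr j)) big_sumType /=.
rewrite [in RHS](bigID (fun k => (lam k <= j)%N)) /=.
rewrite [X in _ = _ + X](bigID (fun l : 'I_n => (lam i <= l)%N)) /=.
have kE : \sum_(k < m | (j < lam k)%N) Phi (inl i) (inr j) (inl k) =
    \sum_(k < m | ~~ (lam k <= j)%N) Phi (inl i) (inr j) (inl k).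
  by apply: eq_bigl => k; rewrite ltnNge.
have lE : \sum_(l < n | (l < lam i)%N) Phi (inl i) (inr j) (inr l) =
    \sum_(l < n | ~~ (lam i <= l)%N) Phi (inl i) (inr j) (inr l).
  by apply: eq_bigl => l; rewrite ltnNge.
by rewrite kE lE; ring.
Qed.

Section MomentPlanes.
Variables (K : fieldType) (alpha beta : 'I_4 -> K).

(** Up to a scalar, H_k has the parameter k/(k+1) and K_l the parameter 1/(l+1). *)
Definition pencil (s : 'I_4) (a : K) : K := (1 - a) * alpha s + a * beta s.

Definition bracket (s t : 'I_4) : K := beta s * alpha t - alpha s * beta t.

Definition plane (a : K) (y : 'rV[K]_4) : K :=
  \sum_s alpha s * beta s / pencil s a * y 0 s.

(** The denominator is chosen to make [plane d] of this vector a third divided difference of a cubic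
    over four nodes, whose value carries the factors a - d, b - d and c - d. *)
Definition triple_point (a b c : K) : 'rV[K]_4 :=
  \row_s (pencil s a * pencil s b * pencil s c /
          (alpha s * beta s * \prod_(t | t != s) bracket s t)).

Hypothesis ab_neq0 : forall s, alpha s * beta s != 0.
Hypothesis bracket_neq0 : forall s t, s != t -> bracket s t != 0.

Definition regular (a : K) : Prop := forall s, pencil s a != 0.

(* In the coordinate [r s], the value is the third divided difference of the cubic
   [(1 + (a - d) r) (1 + (b - d) r) (1 + (c - d) r)]. *)
Lemma plane_triple_point a b c d : regular d ->
  plane d (triple_point a b c) =
  (a - d) * (b - d) * (c - d) / \prod_s pencil s d.
Proof.
move=> d_reg.
pose r s := (beta s - alpha s) / pencil s d.
have pencilE s x : pencil s x = pencil s d * (1 + (x - d) * r s).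
  by rewrite /r /pencil; field; apply: d_reg.
have bracketE s t : bracket s t = pencil s d * pencil t d * (r s - r t).
  by rewrite /bracket /r /pencil; field; apply/andP; split; apply: d_reg.
have r_inj : injective r.
  move=> s t st; apply/eqP/negPn/negP => /bracket_neq0.
  by rewrite bracketE st subrr mulr0 eqxx.
pose q : {poly K} := (1 + (a - d) *: 'X) * (1 + (b - d) *: 'X) * (1 + (c - d) *: 'X).
pose lin (x : K) : {poly K} := 1 + x *: 'X.
have qE : q = \poly_(i < 4) [:: 1; (a - d) + (b - d) + (c - d);
    (a - d) * (b - d) + (a - d) * (c - d) + (b - d) * (c - d);
    (a - d) * (b - d) * (c - d)]`_i.
  rewrite poly_def !big_ord_recl big_ord0 /= /q /bump /=.
  rewrite -!mul_polyC !rmorphD /= !rmorphM /= !rmorphB /= rmorph1.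
  ring.
have q_size : (size q <= #|'I_4|)%N by rewrite card_ord qE size_poly.
have := divided_difference r_inj q_size.
rewrite card_ord /= {2}qE coef_poly /= => <-.
rewrite /plane mulr_suml; apply: eq_bigr => s _.
rewrite mxE /q !hornerE.
have -> : \prod_(t | t != s) bracket s t =
    pencil s d ^+ 3 * (\prod_(t | t != s) pencil t d) * \prod_(t | t != s) (r s - r t).
  under eq_bigr do rewrite bracketE; rewrite !big_split /=.
  rewrite prodr_const; congr (_ ^+ _ * _ * _).
  by rewrite cardC1 card_ord.
rewrite [\prod_s pencil s d](bigD1 s) //= (pencilE s a) (pencilE s b) (pencilE s c).
have P0 : \prod_(t | t != s) pencil t d != 0 by apply/prodf_neq0 => t _; apply: d_reg.
have R0 : \prod_(t | t != s) (r s - r t) != 0.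
  by apply/prodf_neq0 => t ts; rewrite subr_eq0 (inj_eq r_inj) eq_sym.
move: (ab_neq0 s); rewrite mulf_eq0 negb_or => /andP[as0 bs0].
move: P0 R0 (d_reg s); move: (\prod_(t | t != s) pencil t d) (\prod_(t | t != s) (r s - r t)).
rewrite /r; move: (pencil s d) => e P R P0 R0 e0.
by field; rewrite P0 R0 e0 as0 bs0.
Qed.

Lemma plane_linear a k (x y : 'rV[K]_4) :
  plane a (k *: x + y) = k * plane a x + plane a y.
Proof.
rewrite /plane mulr_sumr -big_split; apply: eq_bigr => s _ /=.
by rewrite !mxE; ring.
Qed.

Lemma planeZ a k (x : 'rV[K]_4) : plane a (k *: x) = k * plane a x.
Proof. by rewrite /plane mulr_sumr; apply: eq_bigr => s _; rewrite mxE; ring. Qed.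

Lemma plane_triple_point_eq0 a b c d : regular d ->
  (plane d (triple_point a b c) == 0) = [|| a == d, b == d | c == d].
Proof.
move=> d_reg; rewrite plane_triple_point // !mulf_eq0 invr_eq0 !subr_eq0.
have /negbTE -> : \prod_s pencil s d != 0 by apply/prodf_neq0 => s _; apply: d_reg.
by rewrite orbF -orbA.
Qed.

Lemma triple_point_neq0 a b c d : regular d -> a != d -> b != d -> c != d ->
  triple_point a b c != 0.
Proof.
move=> d_reg /negbTE ad /negbTE bd /negbTE cd; apply/eqP => p0.
have := plane_triple_point_eq0 a b c d_reg; rewrite ad bd cd p0.
by rewrite -(scale0r (0 : 'rV_4)) planeZ mul0r eqxx.
Qed.

(** The four triple points that each omit one plane are a dual basis up to scalars: evaluating the
    planes on them gives an invertible diagonal matrix, which replaces a determinant computation. *)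
Lemma four_planes_eq0 (x : 'I_4 -> K) (y : 'rV[K]_4) : injective x ->
  (forall i, regular (x i)) -> (forall i, plane (x i) y = 0) -> y = 0.
Proof.
move=> x_inj x_reg xy.
pose M := \matrix_(i, s) (alpha s * beta s / pencil s (x i)).
pose other (j : 'I_4) (k : 'I_3) : K := x (lift j k).
pose p j := triple_point (other j 0) (other j 1) (other j (inord 2)).
pose P := \matrix_(s, j) p j 0 s.
have MP i j : (M *m P) i j = plane (x i) (p j).
  by rewrite mxE; apply: eq_bigr => s _; rewrite !mxE.
have MP_diag : M *m P = diag_mx (\row_i plane (x i) (p i)).
  apply/matrixP => i j; rewrite MP !mxE; case: eqVneq => [->|ij]; first by [].
  apply/eqP; rewrite mulr0n plane_triple_point_eq0 // /other !(inj_eq x_inj).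
  have /unlift_some[k -> _] : j != i by rewrite eq_sym.
  rewrite !(inj_eq lift_inj) -!val_eqE /= inordK //.
  by case: k => [[|[|[|k]]] hk].
have M_unit : M \in unitmx.
  have : M *m P \in unitmx.
    rewrite MP_diag unitmxE det_diag unitfE; apply/prodf_neq0 => i _.
    rewrite mxE plane_triple_point_eq0 // /other !(inj_eq x_inj).
    by rewrite -!(eq_sym i) !(negbTE (neq_lift _ _)).
  by rewrite unitmx_mul => /andP[].
apply: trmx_inj; rewrite trmx0 -(mulKmx M_unit y^T).
have -> : M *m y^T = 0.
  apply/matrixP => i j; rewrite mxE [RHS]mxE -[RHS](xy i).
  by apply: eq_bigr => s _; rewrite !mxE ord1.
by rewrite mulmx0.
Qed.

(** The plane d, missing the triple point, determines the scalar; the difference then lies on four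
    planes. *)
Lemma three_planes a b c d (y : 'rV[K]_4) :
  uniq [:: a; b; c; d] -> regular a -> regular b -> regular c -> regular d ->
  plane a y = 0 -> plane b y = 0 -> plane c y = 0 ->
  exists k, y = k *: triple_point a b c.
Proof.
move=> abcd ra rb rc rd ya yb yc.
pose k := plane d y / plane d (triple_point a b c).
have d0 : plane d (triple_point a b c) != 0.
  rewrite plane_triple_point_eq0 //; move: abcd => /=; rewrite !inE !negb_or.
  by case/and4P => /and3P[_ _ ->] /andP[_ ->] ->.
exists k; apply/eqP; rewrite -subr_eq0; apply/eqP.
pose x (i : 'I_4) := [:: a; b; c; d]`_i.
apply: (@four_planes_eq0 x).
- by move=> i j /eqP; rewrite nth_uniq // => /eqP/val_inj.
- by case=> [[|[|[|[|i]]]] hi].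
move=> i; rewrite addrC -scaleNr plane_linear.
have vanish e : regular e -> e \in [:: a; b; c] -> plane e y = 0 ->
    - k * plane e (triple_point a b c) + plane e y = 0.
  move=> re ein ->; rewrite addr0; apply/eqP; rewrite mulf_eq0.
  by rewrite plane_triple_point_eq0 // orbC; move: ein; rewrite !inE !(eq_sym e) => ->.
case: i => [[|[|[|[|i]]]] hi] //=; try by apply: vanish; rewrite ?inE ?eqxx ?orbT.
by rewrite /x /= mulNr divfK // addNr.
Qed.

(** The point is affine in c, so a form of degree e restricts to the line of a and b as a polynomial
    of degree at most e in c. *)
Lemma triple_point_pencil a b c :
  triple_point a b c =
    \row_s ((1 - c) * triple_point a b 0 0 s + c * triple_point a b 1 0 s).
Proof. by apply/rowP => s; rewrite !mxE /pencil; ring. Qed.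

Lemma triple_pointCr a b c : triple_point a b c = triple_point a c b.
Proof. by apply/rowP => s; rewrite !mxE; ring. Qed.

Lemma triple_pointCl a b c : triple_point a b c = triple_point c b a.
Proof. by apply/rowP => s; rewrite !mxE; ring. Qed.

Definition plane_form (a : K) : {mpoly K[4]} :=
  \sum_s (alpha s * beta s / pencil s a) *: 'X_s.

Lemma plane_form_homog a : plane_form a \is 1.-homog for mdeg.
Proof.
by apply: rpred_sum => s _; apply: dhomogZ; rewrite dhomogX /= mdeg1.
Qed.

Lemma meval_plane_form a (y : 'rV[K]_4) : (plane_form a).@[y ord0] = plane a y.
Proof.
rewrite /plane_form rmorph_sum; apply: eq_bigr => s _.
by rewrite /= mevalZ mevalXU.
Qed.

End MomentPlanes.

Lemma size_mul_bound (K : fieldType) (p q : {poly K}) a b :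
  (size p <= a.+1)%N -> (size q <= b.+1)%N -> (size (p * q)%R <= (a + b).+1)%N.
Proof.
move=> pa qb; rewrite (leq_trans (size_polyMleq p q)) // -subn1 leq_subLR add1n.
by rewrite (leq_trans (leq_add pa qb)) // addSn addnS.
Qed.

Lemma poly_on_affine_line (K : fieldType) n d (f : {mpoly K[n.+1]}) (x y : 'rV[K]_n.+1) :
  f \is d.-homog for mdeg ->
  exists2 q : {poly K}, (size q <= d.+1)%N & forall a, q.[a] = f.@[(x + a *: y) ord0].
Proof.
move=> fd; pose h k : {poly K} := (x ord0 k)%:P + y ord0 k *: 'X.
exists (mmap polyC h f) => [|a]; last first.
  rewrite /mmap horner_sum mevalE; apply: eq_bigr => u _.
  rewrite hornerM hornerC /mmap1 horner_prod; congr (_ * _); apply: eq_bigr => i _.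
  by rewrite horner_exp /h !hornerE !mxE mulrC.
have h_size k : (size (h k) <= 2)%N.
  rewrite (leq_trans (size_polyD _ _)) // geq_max (leq_trans (size_polyC_leq1 _)) //=.
  by rewrite (leq_trans (size_scale_leq _ _)) // size_polyX.
rewrite /mmap (leq_trans (size_sum _ _ _)) //; apply/bigmax_leqP_seq => u uf _.
rewrite mul_polyC (leq_trans (size_scale_leq _ _)) //.
have /= <- := dhomogP _ _ _ fd u uf; rewrite mdegE /mmap1.
elim/big_ind2: _ => [|p a q b pa qb|i _]; first by rewrite size_poly1.
  exact: size_mul_bound.
elim: (u i) => [|k IH]; first by rewrite expr0 size_poly1.
by rewrite exprS; apply: (size_mul_bound (a := 1%N)).
Qed.

Lemma lex_le a a' b r r' : (r < b -> a' * b + r' <= a * b + r -> a' <= a)%N.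
Proof.
move=> rb le; rewrite leqNgt; apply/negP => aa'.
have : (a.+1 * b <= a' * b)%N by rewrite leq_mul2r aa' orbT.
by rewrite mulSn; lia.
Qed.

Section PlaneRank.
Variables m n : nat.

Definition plane_rank (c : 'I_m + 'I_n) : nat :=
  match c with inl k => k | inr l => (m + l)%N end.

Lemma plane_rank_lt c : (plane_rank c < m + n)%N.
Proof. by case: c => k /=; have := ltn_ord k; lia. Qed.

Lemma plane_rank_inj : injective plane_rank.
Proof.
move=> [k|k] [l|l] /= E; have kl := ltn_ord k; have ll := ltn_ord l.
- by congr inl; apply/val_inj.
- by exfalso; lia.
- by exfalso; lia.
- by congr inr; apply/val_inj; rewrite /=; lia.
Qed.

End PlaneRank.

(** * The relation between the points and their separators *)

Section Configuration.
Variables (K : numFieldType) (alpha beta : 'I_4 -> K).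
Variables (m n s : nat) (theta : 'I_m + 'I_n -> K) (lam : 'I_m -> nat).
Local Notation T := ('I_m + 'I_n)%type.
Local Notation index := ('I_m * 'I_n * T)%type.
Local Notation plane := (plane alpha beta).
Local Notation triple_point := (triple_point alpha beta).

Hypothesis ab_neq0 : forall i, alpha i * beta i != 0.
Hypothesis bracket_neq0 : forall i j, i != j -> bracket alpha beta i j != 0.
Hypothesis theta_inj : injective theta.
Hypothesis theta_reg : forall c, regular alpha beta (theta c).
Hypothesis mn : (m + n = s + 3)%N.

(* [(i, j, c)] stands for the point of [H_i], [K_j] and the plane [c]; it lies on
   the line [H_i], [K_j] of the curve and on a line of the residual curve. *)
Definition configuration : pred index := fun x =>
  (x.1.2 < lam x.1.1)%N && match x.2 with
  | inl k => (lam k <= x.1.2)%N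
  | inr l => (lam x.1.1 <= l)%N
  end.

Definition index_point (x : index) : 'rV[K]_4 :=
  triple_point (theta (inl x.1.1)) (theta (inr x.1.2)) (theta x.2).

Let node_weight a : K := \prod_(d | d != a) (theta a - theta d).

(* The residue at the triple point of [1 / \prod_d plane d]. *)
Definition point_weight (a b c : T) : K :=
  (theta b - theta a) * (theta c - theta a) * (theta c - theta b) /
  (node_weight a * node_weight b * node_weight c).

Lemma configuration_neq x : configuration x ->
  [/\ inl x.1.1 != x.2, inr x.1.2 != x.2 & inl x.1.1 != inr x.1.2 :> T].
Proof.
case: x => [[i j] [k|l]] /andP[/= ji] H; split=> //; apply/eqP => -[E].
  by move: H; rewrite -E leqNgt ji.
by move: H; rewrite -E leqNgt ji.
Qed.

Lemma point_weight_neq0 x : configuration x ->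
  point_weight (inl x.1.1) (inr x.1.2) x.2 != 0.
Proof.
move=> /configuration_neq[ac bc ab].
have w0 a : node_weight a != 0.
  by apply/prodf_neq0 => d da; rewrite subr_eq0 (inj_eq theta_inj) eq_sym.
by rewrite /point_weight !mulf_neq0 ?invr_eq0 ?mulf_neq0 // subr_eq0
  (inj_eq theta_inj) eq_sym.
Qed.

Lemma configuration_relation f : f \is (s.-1).-homog for mdeg -> (0 < s)%N ->
  \sum_(x | configuration x)
    f.@[index_point x ord0] * point_weight (inl x.1.1) (inr x.1.2) x.2 = 0.
Proof.
move=> fd s0.
pose Phi a b c :=
  f.@[triple_point (theta a) (theta b) (theta c) ord0] * point_weight a b c.
have Phi_r a b c : Phi a b c = - Phi a c b.
  rewrite /Phi triple_pointCr -mulrN; congr (_ * _).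
  rewrite /point_weight -mulNr; congr (_ / _); ring.
have Phi_l a b c : Phi a b c = - Phi c b a.
  rewrite /Phi triple_pointCl -mulrN; congr (_ * _).
  rewrite /point_weight -mulNr; congr (_ / _); ring.
have line_sum a b : \sum_c Phi a b c = 0.
  pose x := triple_point (theta a) (theta b) 0.
  pose y := triple_point (theta a) (theta b) 1 - x.
  have [q q_size qE] := poly_on_affine_line x y fd.
  (* The two factors remove the nodes c = a and c = b. As [r] has degree at most s + 1 and there are
     s + 3 nodes, its top divided difference is zero. *)
  pose r := q * ('X - (theta a)%:P) * ('X - (theta b)%:P).
  have r_size : (size r < #|{: T}|)%N.
    rewrite card_sum !card_ord mn.
    apply: (@leq_ltn_trans (s.-1 + 1 + 1).+1); last by lia.
    apply: size_mul_bound; last by rewrite size_XsubC.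
    by apply: size_mul_bound; rewrite ?size_XsubC // prednK in q_size *.
  have := divided_difference theta_inj (ltnW r_size).
  rewrite [RHS]nth_default; last by move: r_size; case: #|_|.
  move=> sum0; transitivity ((theta b - theta a) / (node_weight a * node_weight b) *
    \sum_c r.[theta c] / node_weight c); last by rewrite sum0 mulr0.
  rewrite mulr_sumr; apply: eq_bigr => c _.
  have -> : r.[theta c] = f.@[triple_point (theta a) (theta b) (theta c) ord0] *
      (theta c - theta a) * (theta c - theta b).
    have -> : triple_point (theta a) (theta b) (theta c) = x + theta c *: y.
      by rewrite [LHS]triple_point_pencil; apply/rowP => k; rewrite !mxE; ring.
    by rewrite /r !hornerE qE.
  by rewrite /Phi /point_weight !invfM; ring.
rewrite -[RHS](alternating_residue_sum lam Phi_r Phi_l line_sum).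
transitivity (\sum_(ij : 'I_m * 'I_n | (ij.2 < lam ij.1)%N)
    \sum_(c | configuration (ij, c)) Phi (inl ij.1) (inr ij.2) c).
  by rewrite pair_big_dep; apply: eq_big => [[[i j] c]|[[i j] c] _] //=;
    rewrite andb_idl // => /andP[].
rewrite [RHS]pair_big_dep /=; apply: eq_bigr => -[i j] /= ji.
rewrite big_sumType /=; congr (_ + _); apply: eq_bigl => k.
- by rewrite /configuration /= ji.
- by rewrite /configuration /= ji.
Qed.

Hypothesis lam_sorted : forall i k : 'I_m, (i <= k)%N -> (lam k <= lam i)%N.
Hypothesis lam_le : forall i, (lam i <= n)%N.

Definition earlier (x : index) : pred T :=
  fun c => configuration (x.1, c) && (plane_rank c < plane_rank x.2)%N.

(** It kills the points preceding x when rows are read downwards, columns from right to left and the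
    points of a line by rank. Reading columns from the right makes the degrees on the line (i, j)
    end at s - i' - j, with i' the position of i counted from the bottom of column j, as the degree
    count requires. *)
Definition separator_form (x : index) : {mpoly K[4]} :=
  (\prod_(i < m | (i < x.1.1)%N) plane_form alpha beta (theta (inl i))) *
  (\prod_(j < n | (x.1.2 < j < lam x.1.1)%N) plane_form alpha beta (theta (inr j))) *
  \prod_(c | earlier x c) plane_form alpha beta (theta c).

Definition separator_degree (x : index) : nat :=
  (x.1.1 + (lam x.1.1 - x.1.2.+1) + #|earlier x|)%N.

Definition separator_key (x : index) : nat :=
  ((x.1.1 * n + (n - x.1.2.+1)) * (m + n) + plane_rank x.2)%N.

Lemma separator_homog x : separator_form x \is (separator_degree x).-homog for mdeg.
Proof.
have prod_homog (I : finType) (P : pred I) (g : I -> K) :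
    \prod_(i | P i) plane_form alpha beta (g i) \is (\sum_(i | P i) 1)%N.-homog for mdeg.
  apply: (big_ind2 (fun (f : {mpoly K[4]}) d => f \is d.-homog for mdeg)).
  - exact: dhomog1.
  - by move=> f d f' d' fd fd'; apply: dhomogM.
  - by move=> i _; apply: plane_form_homog.
have -> : separator_degree x = ((\sum_(i < m | (i < x.1.1)%N) 1) +
    (\sum_(j < n | (x.1.2 < j < lam x.1.1)%N) 1) + \sum_(c | earlier x c) 1)%N.
  rewrite /separator_degree; congr (_ + _ + _)%N; last by rewrite sum1_card.
    by rewrite (big_ord_narrow (ltnW (ltn_ord x.1.1))) sum1_card card_ord.
  rewrite (eq_bigl (fun j : 'I_n => (x.1.2 < j)%N && (j < lam x.1.1)%N)) //.
  rewrite (big_ord_narrow_cond (lam_le x.1.1)) /=.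
  transitivity (\sum_(x.1.2.+1 <= k < lam x.1.1) 1)%N.
    by rewrite sum_nat_const_nat muln1.
  by rewrite big_geq_mkord.
by apply: dhomogM; first apply: dhomogM.
Qed.

Lemma separator_eval x (y : 'rV[K]_4) : (separator_form x).@[y ord0] =
  (\prod_(i < m | (i < x.1.1)%N) plane (theta (inl i)) y) *
  (\prod_(j < n | (x.1.2 < j < lam x.1.1)%N) plane (theta (inr j)) y) *
  \prod_(c | earlier x c) plane (theta c) y.
Proof.
rewrite /separator_form !mevalM !rmorph_prod; congr (_ * _ * _);
by apply: eq_bigr => i _; rewrite -meval_plane_form.
Qed.

Lemma plane_index_point c x :
  (plane (theta c) (index_point x) == 0) =
  [|| inl x.1.1 == c, inr x.1.2 == c | x.2 == c].
Proof. by rewrite plane_triple_point_eq0 // !(inj_eq theta_inj). Qed.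

(** A factor H_k with k < i through the point would need [lam k <= j < lam i], against the sorting
    of the rows; a factor K_l would need [lam i <= l]. *)
Lemma separator_diag x : configuration x -> (separator_form x).@[index_point x ord0] != 0.
Proof.
case: x => [[i j] c] /andP[/= ji xc]; rewrite separator_eval !mulf_neq0 //.
- apply/prodf_neq0 => k /= ki; rewrite plane_index_point !negb_or.
  apply/and3P; split; [|by []|]; apply/eqP => /= E.
    by move: E ki => -[->]; rewrite ltnn.
  move: xc; rewrite E leqNgt (leq_trans ji) //.
  by apply: lam_sorted; apply: ltnW.
- apply/prodf_neq0 => k /= /andP[jk ki]; rewrite plane_index_point !negb_or.
  apply/and3P; split; [by []| |]; apply/eqP => /= E.
    by move: E jk => -[->]; rewrite ltnn.
  by move: xc; rewrite E leqNgt ki.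
- apply/prodf_neq0 => d /andP[/= dx dc]; rewrite plane_index_point !negb_or.
  have [d1 d2 _] := configuration_neq dx.
  by apply/and3P; split=> //; apply/eqP => /= E; move: dc; rewrite E ltnn.
Qed.

Lemma separator_triangular x y : configuration x -> configuration y -> y != x ->
  (separator_key y <= separator_key x)%N -> (separator_form x).@[index_point y ord0] = 0.
Proof.
move=> xC yC yx key; apply/eqP; rewrite separator_eval !mulf_eq0.
case: x y => [[i j] c] [[i' j'] c'] in xC yC yx key *.
move: key; rewrite /separator_key /= => key.
have cr := plane_rank_lt c; have cr' := plane_rank_lt c'.
have jr : (n - j.+1 < n)%N by have := ltn_ord j; lia.
have keyA := lex_le cr key; have keyB := lex_le jr keyA.
have [ii'|i'i|ii'] := ltngtP i i'.
- by move: ii'; rewrite ltnNge keyB.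
- rewrite -orbA; apply/orP; left; rewrite (bigD1 i') //= mulf_eq0.
  by rewrite plane_index_point /= eqxx.
have {}ii' : i = i' by apply/val_inj.
subst i'; have [jj'|j'j|jj'] := ltngtP j j'.
- rewrite -orbA; apply/orP; right; apply/orP; left; rewrite (bigD1 j') /=.
    by rewrite mulf_eq0 plane_index_point /= eqxx ?orbT.
  by rewrite jj'; case/andP: yC.
- by exfalso; move: keyA jr; rewrite leq_add2l; have := ltn_ord j; lia.
have {}jj' : j = j' by apply/val_inj.
subst j'; apply/orP; right; rewrite (bigD1 c') /=.
  by rewrite mulf_eq0 plane_index_point /= eqxx ?orbT.
rewrite /earlier yC /= ltn_neqAle (inj_eq (@plane_rank_inj m n)).
apply/andP; split; last by move: key; rewrite leq_add2l.
by apply: contra_neq yx => ->.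
Qed.

End Configuration.

(** * Counting degrees *)

(** The number of predecessors is injective on P and bounded by [#|P|], so each smaller value occurs
    exactly once. *)
Lemma card_rank (T : finType) (P : pred T) (rank : T -> nat) q : injective rank ->
  #|[pred c | P c & #|[pred d | P d && (rank d < rank c)%N]| == q]| = (q < #|P|)%N.
Proof.
move=> rank_inj; pose g c := #|[pred d | P d && (rank d < rank c)%N]|.
have g_lt c d : P c -> (rank c < rank d)%N -> (g c < g d)%N.
  move=> Pc cd; apply: proper_card; apply/fintype.properP; split.
    by apply/fintype.subsetP => e; rewrite !inE => /andP[-> /= /ltn_trans]; apply.
  by exists c; rewrite !inE Pc ?cd ?ltnn.
have g_inj : {in P &, injective g}.
  move=> c d Pc Pd gcd; apply: rank_inj; apply/eqP.
  have [/(g_lt _ _ Pc)|/(g_lt _ _ Pd)|//] := ltngtP; by rewrite gcd ltnn.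
have g_bound c : P c -> (g c < #|P|)%N.
  move=> Pc; rewrite -(eq_card (A := [pred d | P d]) (fun=> erefl)).
  apply: proper_card; apply/fintype.properP; split.
    by apply/fintype.subsetP => e; rewrite !inE => /andP[].
  by exists c; rewrite ?inE ?ltnn ?andbF.
have [|||_ gE] := uniq_min_size (s1 := [seq g c | c <- enum P]) (s2 := iota 0 #|P|).
- rewrite map_inj_in_uniq ?enum_uniq // => c d; rewrite !mem_enum; exact: g_inj.
- move=> _ /mapP[c cP ->]; rewrite mem_iota add0n /=; apply: g_bound.
  by move: cP; rewrite mem_enum.
- by rewrite size_iota size_map -cardE.
have -> : (q < #|P|)%N = (q \in [seq g c | c <- enum P]) by rewrite gE mem_iota.
rewrite -count_uniq_mem; last first.
  rewrite map_inj_in_uniq ?enum_uniq // => c d; rewrite !mem_enum; exact: g_inj.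
rewrite count_map -size_filter cardE; congr size; rewrite /enum_mem.
by rewrite -filter_predI; apply: eq_filter => c; rewrite /= !inE andbC.
Qed.

Section Diagrams.
Local Open Scope nat_scope.

Lemma sum_initial_segment N (P : pred nat) (G : nat -> nat) :
  (forall i k, i <= k < N -> P k -> P i) ->
  \sum_(0 <= i < N | P i) G i = \sum_(0 <= i < \sum_(0 <= i < N | P i) 1) G i.
Proof.
elim: N => [|N IH] closed; first by rewrite !big_geq.
have recr H : \sum_(0 <= i < N.+1 | P i) H i =
    \sum_(0 <= i < N | P i) H i + if P N then H N else 0.
  by rewrite big_mkcond big_nat_recr //= -big_mkcond.
have [PN|nPN] := boolP (P N); last first.
  rewrite !recr (negbTE nPN) !addn0 IH // => i k /andP[ik kN].
  by apply: closed; rewrite ik ltnW.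
have allP i : i <= N -> P i by move=> iN; apply: closed PN; rewrite iN ltnS leqnn.
have full H : \sum_(0 <= i < N.+1 | P i) H i = \sum_(0 <= i < N.+1) H i.
  rewrite big_nat_cond [RHS]big_nat_cond; apply: eq_bigl => i.
  by rewrite andbT; case: leqP => //= iN; rewrite allP.
by rewrite !full sum_nat_const_nat muln1.
Qed.

Variables (m n : nat) (lam : nat -> nat).
Hypothesis lam_sorted : forall i k, i <= k < m -> lam k <= lam i.
Hypothesis lam_le : forall i, i < m -> lam i <= n.

(** The conjugate partition of [lam]. *)
Definition column j := \sum_(0 <= i < m | j < lam i) 1.

Lemma sum_column j (G : nat -> nat) :
  \sum_(0 <= i < m | j < lam i) G i = \sum_(0 <= i < column j) G i.
Proof.
by apply: sum_initial_segment => i k /lam_sorted lik /leq_trans; apply.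
Qed.

Lemma column_gt i j : i < m -> j < lam i -> i < column j.
Proof.
move=> im ji; rewrite /column (big_cat_nat _ (n := i.+1)) //= ltn_addr //.
rewrite big_nat_cond (eq_bigl (fun k => (0 <= k < i.+1) && true)).
  by rewrite -big_nat_cond sum_nat_const_nat subn0 muln1.
move=> k; rewrite andbT; case: leqP => //= ki.
by rewrite (leq_trans ji) // lam_sorted // -ltnS ki.
Qed.

Lemma column_le j : column j <= m.
Proof.
by rewrite /column big_mkcond -[X in _ <= X]muln1 -[X in X * _]subn0
  -sum_nat_const_nat leq_sum // => i _; case: ifP.
Qed.

Lemma box_sum_columns (G : nat -> nat -> nat) :
  \sum_(0 <= i < m) \sum_(0 <= j < n | j < lam i) G i j =
  \sum_(0 <= j < n) \sum_(0 <= i < column j) G i j.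
Proof.
rewrite (exchange_big_dep_nat predT) //=; apply: eq_bigr => j _.
exact: (sum_column j (G ^~ j)).
Qed.

Lemma sum_rev k (G : nat -> nat) :
  \sum_(0 <= i < k) G i = \sum_(0 <= i < k) G (k - i.+1).
Proof. by rewrite big_nat_rev add0n. Qed.

Lemma sum_row i (G : nat -> nat) : i < m ->
  \sum_(0 <= j < n | j < lam i) G j = \sum_(0 <= j < lam i) G j.
Proof.
move=> im; rewrite (big_nat_widen _ _ _ _ _ (lam_le im)).
by [].
Qed.

(* The box [(i, j)] contributes the degrees from [i + (lam i - 1 - j)] to
   [s + 1 + i - j - column j]: the first bounds are the [i + j] reversed along rows,
   the last bounds are the [s - i - j] reversed along columns. *)
Lemma degree_count s e : m + n = s + 3 ->
  \sum_(0 <= i < m) \sum_(0 <= j < n | j < lam i)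
     ((i + (lam i - j.+1) <= e) &&
      (e < i + (lam i - j.+1) + ((m - column j) + (n - lam i)))) +
  \sum_(0 <= i < m) \sum_(0 <= j < n | j < lam i) (s < e + (i + j)) =
  \sum_(0 <= i < m) \sum_(0 <= j < n | j < lam i) (i + j <= e).
Proof.
move=> mn.
have -> : \sum_(0 <= i < m) \sum_(0 <= j < n | j < lam i) (i + j <= e) =
    \sum_(0 <= i < m) \sum_(0 <= j < n | j < lam i) (i + (lam i - j.+1) <= e).
  rewrite big_nat_cond [RHS]big_nat_cond; apply: eq_bigr => i /andP[im _].
  by rewrite sum_row // [RHS]sum_row // [LHS]sum_rev.
have -> : \sum_(0 <= i < m) \sum_(0 <= j < n | j < lam i) (s < e + (i + j)) =
    \sum_(0 <= i < m) \sum_(0 <= j < n | j < lam i)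
       (i + (lam i - j.+1) + ((m - column j) + (n - lam i)) <= e).
  rewrite (box_sum_columns (fun i j => s < e + (i + j) : nat)).
  transitivity (\sum_(0 <= j < n) \sum_(0 <= i < column j)
      (s + 2 + i <= e + j + column j : nat)).
    apply: eq_bigr => j _; rewrite [LHS]sum_rev big_nat_cond [RHS]big_nat_cond.
    by apply: eq_bigr => i /andP[/andP[_ ij] _]; congr nat_of_bool; lia.
  rewrite -(box_sum_columns (fun i j => s + 2 + i <= e + j + column j : nat)).
  rewrite big_nat_cond [RHS]big_nat_cond; apply: eq_bigr => i /andP[/andP[_ im] _].
  apply: eq_bigr => j ji; congr nat_of_bool.
  have := column_gt im ji; have := lam_le im; have := column_le j; lia.
rewrite -big_split; apply: eq_bigr => i _; rewrite -big_split; apply: eq_bigr => j _ /=.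
by case: leqP => ? /=; case: ltnP => ?; lia.
Qed.

End Diagrams.

(** Column j has as many boxes as there are d with j < a d, whatever the order of the rows. Those d
    form an interval starting at j, so the i-th box of the column matches d = i + j. *)
Lemma box_sum_diagonals (m n : nat) (lam a : nat -> nat) (sigma : seq nat)
    (F : nat -> nat) :
  (forall i k, i <= k < m -> lam k <= lam i)%N ->
  perm_eq sigma (iota 0 m) -> (forall i, lam i = a (nth 0 sigma i))%N ->
  (forall d, d < m -> a d <= d.+1)%N -> (forall d, d < m -> a d <= n)%N ->
  (forall d, d.+1 < m -> a d <= d -> a d.+1 <= a d)%N ->
  (\sum_(0 <= i < m) \sum_(0 <= j < n | j < lam i) F (i + j) =
   \sum_(0 <= d < m) a d * F d)%N.
Proof.
move=> lam_sorted sigma_perm lamE a_le a_n a_step.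
rewrite (box_sum_columns n lam_sorted (fun i j => F (i + j)%N)).
have colE j : column m lam j = (\sum_(0 <= d < m | j < a d) 1)%N.
  have sz : size sigma = m by rewrite (perm_size sigma_perm) size_iota.
  transitivity (\sum_(d <- sigma | j < a d) 1)%N; last first.
    by rewrite (perm_big _ sigma_perm) /index_iota subn0.
  by rewrite (big_nth 0%N) sz; apply: eq_bigl => i; rewrite lamE.
(* While a e > e the bound j <= e already gives j < a e; once a e <= e the sequence no longer
   increases. *)
have closed j d e : (j <= d <= e)%N -> (e < m)%N -> (j < a e)%N -> (j < a d)%N.
  move=> /andP[jd]; elim: e => [|e IH]; first by rewrite leqn0 => /eqP ->.
  rewrite leq_eqVlt ltnS => /orP[/eqP -> //|de em jae].
  apply: IH => //; first exact: ltnW.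
  have [aee|] := leqP (a e) e; last by apply: leq_ltn_trans; apply: leq_trans de.
  exact: leq_trans jae (a_step _ em aee).
transitivity (\sum_(0 <= j < n) \sum_(0 <= d < m | j < a d) F d)%N; last first.
  rewrite (exchange_big_dep_nat predT) //= big_nat_cond [RHS]big_nat_cond.
  apply: eq_bigr => d /andP[/andP[_ dm] _].
  by rewrite -(big_nat_widen _ _ _ xpredT) ?a_n // sum_nat_const_nat subn0.
apply: eq_bigr => j _; rewrite colE.
have shift H : (\sum_(0 <= d < m | j < a d) H d =
    \sum_(0 <= i < m - j | j < a (i + j)) H (i + j))%N.
  have [mj|jm] := leqP m j.
    have -> : (m - j = 0)%N by lia.
    rewrite [RHS]big_geq // big_nat_cond big1 // => d /andP[/andP[_ dm] jad].
    by have := a_le _ dm; lia.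
  rewrite (big_cat_nat _ (n := j)) ?(ltnW jm) //= [X in (X + _)%N]big_nat_cond.
  rewrite big1 ?add0n => [|d /andP[/andP[_ dj] jad]]; last first.
    by have := a_le d (ltn_trans dj jm); lia.
  by rewrite -{1}[j]add0n big_addn.
rewrite !shift [RHS](@sum_initial_segment _ (fun i => (j < a (i + j)%N)%N)
  (fun i => F (i + j)%N)) // => i k /andP[ik km].
by apply: closed; lia.
Qed.

Lemma numField_poly_eq0 (K : numFieldType) (q : {poly K}) :
  (forall a, q.[a] = 0) -> q = 0.
Proof.
move=> q0; apply/eqP/negPn/negP => nq0.
have := max_poly_roots (rs := [seq k%:R | k <- iota 0 (size q)]) nq0.
rewrite size_map size_iota ltnn map_inj_uniq ?iota_uniq; last first.
  by move=> i j /eqP; rewrite eqr_nat => /eqP.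
by move=> H; suff: false by []; apply: H => //; apply/allP => x _; rewrite rootE q0.
Qed.

(** * The Gorenstein property and the h-vector of the configuration *)

Section ConfigurationTheorem.
Variables (K : numFieldType) (alpha beta : 'I_4 -> K).
Variables (m n s : nat) (theta : 'I_m + 'I_n -> K) (z : K) (lam : nat -> nat).
Local Notation T := ('I_m + 'I_n)%type.
Local Notation index := ('I_m * 'I_n * T)%type.
Local Notation rows := (fun i : 'I_m => lam i).
Local Notation points := (index_point alpha beta theta).
Local Notation degree := (separator_degree rows).

Hypothesis ab_neq0 : forall i, alpha i * beta i != 0.
Hypothesis bracket_neq0 : forall i j, i != j -> bracket alpha beta i j != 0.
Hypothesis theta_inj : injective theta.
Hypothesis theta_reg : forall c, regular alpha beta (theta c).
Hypothesis z_reg : regular alpha beta z.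
Hypothesis z_theta : forall c, theta c != z.
Hypothesis mn : (m + n = s + 3)%N.
Hypothesis lam_sorted : forall i k, (i <= k < m)%N -> (lam k <= lam i)%N.
Hypothesis lam_le : forall i, (i < m)%N -> (lam i <= n)%N.

Lemma card_line_points (i : 'I_m) (j : 'I_n) : (j < lam i)%N ->
  #|[pred c | configuration rows ((i, j), c)]| =
  ((m - column m lam j) + (n - lam i))%N.
Proof.
move=> ji; rewrite -sum1_card big_sumType /=; congr (_ + _)%N.
  rewrite (eq_bigl (fun k : 'I_m => ~~ (j < lam k)%N)); last first.
    by move=> k; rewrite !inE /configuration /= ji leqNgt.
  have mE : (column m lam j + \sum_(k < m | ~~ (j < lam k)) 1)%N = m.
    rewrite /column big_mkord -[RHS](card_ord m) -[RHS]sum1_card.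
    by rewrite [RHS](bigID (fun k : 'I_m => (j < lam k)%N)).
  by move: mE => /(congr1 (subn^~ (column m lam j))); rewrite addKn.
rewrite (eq_bigl (fun l : 'I_n => (lam i <= l)%N)); last first.
  by move=> l; rewrite !inE /configuration /= ji.
have -> : (n - lam i = \sum_(lam i <= l < n) 1)%N by rewrite sum_nat_const_nat muln1.
by rewrite big_geq_mkord.
Qed.

(** On the line (i, j) only the number of earlier points varies, so by [card_rank] the degrees are
    consecutive, one point in each. *)
Lemma card_configuration e :
  #|[pred x : index | configuration rows x & degree x == e]| =
  (\sum_(0 <= i < m) \sum_(0 <= j < n | j < lam i)
     ((i + (lam i - j.+1) <= e) &&
      (e < i + (lam i - j.+1) + ((m - column m lam j) + (n - lam i)))))%N.
Proof.
rewrite big_mkord; under eq_bigr do rewrite big_mkord.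
rewrite pair_big_dep /= -sum1_card.
transitivity (\sum_(ij : 'I_m * 'I_n | (ij.2 < lam ij.1)%N)
    \sum_(c | configuration rows (ij, c) && (degree (ij, c) == e)) 1)%N.
  rewrite pair_big_dep; apply: eq_bigl => -[[i j] c] /=.
  by rewrite !inE /configuration /=; case: (j < lam i)%N.
apply: eq_bigr => -[i j] /= ji; rewrite -(card_line_points ji) sum1_card.
have degE c : degree ((i, j), c) = (i + (lam i - j.+1) +
    #|[pred d | configuration rows ((i, j), d) && (plane_rank d < plane_rank c)]|)%N.
  by [].
have [st|st] := leqP (i + (lam i - j.+1)) e; last first.
  rewrite /=; apply: eq_card0 => c; rewrite [LHS]unfold_in degE [RHS]inE.
  by apply/negbTE; rewrite negb_and orbC; apply/orP; left; apply/eqP => E; lia.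
rewrite /= -ltn_subLR // -(card_rank _ (e - (i + (lam i - j.+1)))%N (@plane_rank_inj m n)).
apply: eq_card => c; rewrite [LHS]unfold_in [RHS]unfold_in /= degE; congr (_ && _).
by rewrite -{1}(subnKC st) eqn_add2l.
Qed.

Definition configuration_set : set (proj K 3) :=
  [set q | exists2 x : index, configuration rows x & q = pt (points x)].

Variable h : nat -> nat.
Hypothesis h_count : forall e,
  #|[pred x : index | configuration rows x & degree x == e]| = h e.
Hypothesis h_sym : forall e, (e <= s)%N -> h e = h (s - e)%N.
Hypothesis h_high : forall e, (s < e)%N -> h e = 0%N.
Hypothesis h0 : (0 < h 0)%N.
Hypothesis s_gt0 : (0 < s)%N.

Local Notation N := #|configuration rows : pred index|.
Let x_ (a : 'I_N) : index := enum_val a.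
Let M a := plane alpha beta z (points (x_ a)).
Let p a := (M a)^-1 *: points (x_ a).

Let M_neq0 a : M a != 0.
Proof.
by rewrite plane_triple_point_eq0 // !negb_or !z_theta.
Qed.

Let point_setE : point_set p = configuration_set.
Proof.
apply/seteqP; split=> q.
  move=> [a _ <-]; exists (x_ a); first exact: (enum_valP a).
  by rewrite pt_scale // invr_neq0.
move=> [x xC ->]; exists (enum_rank_in xC x) => //.
rewrite /p pt_scale ?invr_neq0 // /x_ enum_rankK_in //.
Qed.

Let p_homog d f a : f \is d.-homog for mdeg ->
  f.@[p a ord0] = (M a)^-1 ^+ d * f.@[points (x_ a) ord0].
Proof. by move=> fd; rewrite /p (meval_scale_homog _ _ fd). Qed.

Let card_h e : #|[pred a : 'I_N | degree (x_ a) == e]| = h e.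
Proof.
rewrite -h_count -sum1_card -[RHS]sum1_card.
rewrite (eq_bigl (fun x => configuration rows x && (degree x == e))) //.
rewrite (big_enum_val_cond (A := configuration rows) (fun x => degree x == e)
  (fun=> 1%N)) //=.
Qed.

Lemma configuration_gorenstein :
  gorenstein_zeroscheme configuration_set /\
  forall d, h_vector configuration_set d = (h d)%:Z.
Proof.
have lam_sorted' (i k : 'I_m) : (i <= k)%N -> (lam k <= lam i)%N.
  by move=> ik; apply: lam_sorted; rewrite ik ltn_ord.
have lam_le' (i : 'I_m) : (lam i <= n)%N by apply: lam_le.
(* The power of [M a] undoes the normalization of the representatives, which scales forms of degree
   s - 1. *)
pose c a := point_weight theta (inl (x_ a).1.1) (inr (x_ a).1.2) (x_ a).2 *
  M a ^+ s.-1.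
have N0 : (0 < N)%N.
  have : (0 < #|[pred a : 'I_N | degree (x_ a) == 0]|)%N by rewrite card_h.
  by move=> /card_gt0P[a _]; apply: leq_trans (ltn_ord a).
have l_one a : (plane_form alpha beta z).@[p a ord0] = 1.
  by rewrite (p_homog _ (plane_form_homog _ _ _)) meval_plane_form expr1 mulVf.
have c0 a : c a != 0.
  apply: mulf_neq0; last exact: expf_neq0.
  exact: (point_weight_neq0 theta_inj (enum_valP a)).
have rel g : g \is (s.-1).-homog for mdeg -> \sum_a c a * g.@[p a ord0] = 0.
  move=> gd.
  rewrite -[RHS](configuration_relation alpha beta rows theta_inj mn gd s_gt0).
  rewrite [RHS]big_enum_val /=; apply: eq_bigr => a _.
  rewrite (p_homog _ gd) /c -/(x_ a) [RHS]mulrC -mulrA; congr (_ * _).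
  by rewrite exprVn mulrA divff ?mul1r // expf_neq0.
have f_homog a : separator_form alpha beta theta rows (x_ a) \is
    (degree (x_ a)).-homog for mdeg by apply: separator_homog.
have f_diag a : (separator_form alpha beta theta rows (x_ a)).@[p a ord0] != 0.
  rewrite (p_homog _ (f_homog a)) mulf_neq0 ?expf_neq0 ?invr_neq0 //.
  exact: (separator_diag ab_neq0 bracket_neq0 theta_inj theta_reg lam_sorted'
    (enum_valP a)).
have f_tri a b : b != a -> (separator_key (x_ b) <= separator_key (x_ a))%N ->
    (separator_form alpha beta theta rows (x_ a)).@[p b ord0] = 0.
  move=> ba key; rewrite (p_homog _ (f_homog a)).
  rewrite (separator_triangular ab_neq0 bracket_neq0 theta_inj theta_reg mn
    (enum_valP a) (enum_valP b) _ key) ?mulr0 //.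
  by rewrite (inj_eq enum_val_inj).
have deg_le a : (degree (x_ a) <= s)%N.
  rewrite leqNgt; apply/negP => /h_high; rewrite -card_h => /card0_eq/(_ a).
  by rewrite !inE eqxx.
have deg_sym e : (e <= s)%N ->
    #|[pred a : 'I_N | degree (x_ a) == e]| =
    #|[pred a : 'I_N | degree (x_ a) == (s - e)%N]|.
  by move=> es; rewrite !card_h h_sym.
rewrite -point_setE; split.
  exact: (points_gorenstein_zeroscheme (@numField_poly_eq0 K) N0
    (plane_form_homog alpha beta z) l_one c0 rel f_homog f_diag f_tri s_gt0 deg_le
    deg_sym).
move=> d; rewrite (points_h_vector (@numField_poly_eq0 K) N0
    (plane_form_homog alpha beta z) l_one c0 rel f_homog f_diag f_tri s_gt0 deg_le
    deg_sym) //.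
by congr Posz; apply: card_h.
Qed.

End ConfigurationTheorem.

(** * Hadamard products of lines *)

Section LinearStar.
Variable K : fieldType.
Implicit Types (a b d : 'I_4 -> K).

Lemma L_pt a b (x : 'rV[K]_4) : x != 0 ->
  L a b (pt x) <-> \sum_s a s * x 0 s = 0 /\ \sum_s b s * x 0 s = 0.
Proof.
move=> x0; split=> [H|[ax bx] y].
  by apply: H; rewrite line_pt // memv_line.
rewrite line_pt // => /vlineP[k ->].
have scale e : \sum_s e s * (k *: x) ord0 s = k * \sum_s e s * x 0 s.
  by rewrite mulr_sumr; apply: eq_bigr => s _; rewrite mxE mulrCA.
by rewrite !scale ax bx mulr0.
Qed.

Lemma L_closed a b : zariski_closed (L a b).
Proof.
pose lin (e : 'I_4 -> K) : {mpoly K[4]} := \sum_s e s *: 'X_s.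
have linE e (x : 'rV[K]_4) : (lin e).@[x ord0] = \sum_s e s * x ord0 s.
  rewrite /lin rmorph_sum; apply: eq_bigr => s _.
  by rewrite /= mevalZ mevalXU.
have lin_homog e : homogeneous (lin e).
  exists 1%N; apply: rpred_sum => s _.
  by apply: dhomogZ; rewrite dhomogX /= mdeg1.
exists [set lin a; lin b] => [_ [->|->]|]; [exact: lin_homog|exact: lin_homog|].
apply/seteqP; split=> q Lq.
  by move=> f [->|->] x /Lq[ax bx]; rewrite linE.
move=> x xq; split.
  by rewrite -linE; apply: (Lq (lin a)) => //; left.
by rewrite -linE; apply: (Lq (lin b)) => //; right.
Qed.

Lemma zariski_closure_closed n (Y : set (proj K n)) :
  zariski_closed Y -> zariski_closure Y = Y.
Proof. by move=> Yc; apply/seteqP; split; [apply: smallest_sub|apply: sub_smallest]. Qed.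

(** Without zero coordinates the product with a point is an automorphism of the projective space;
    the image of the line is already closed, so the closure adds nothing. *)
Lemma star_linear d a b : (forall s, d s != 0) ->
  star (pt (\row_s d s)) (L a b) = L (fun s => a s / d s) (fun s => b s / d s).
Proof.
move=> d0; rewrite /star.
have row_d0 : \row_s d s != 0.
  by apply/eqP => /rowP/(_ 0); rewrite !mxE => /eqP; rewrite (negbTE (d0 0)).
suff -> : [set r | exists2 q, L a b q & hadamard (pt (\row_s d s)) q r] =
    L (fun s => a s / d s) (fun s => b s / d s).
  by apply: zariski_closure_closed; apply: L_closed.
apply/seteqP; split=> q /=.
  move=> [q' Lq' [x [y [/= xd yq' xy0 ->]]]]; apply/L_pt => //.
  have [ay by_] := Lq' _ yq'.
  move: xd; rewrite line_pt // => /vlineP[k xk].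
  have scale (e : 'I_4 -> K) : \sum_s e s / d s * (\row_i (x ord0 i * y ord0 i)) 0 s =
      k * \sum_s e s * y ord0 s.
    rewrite mulr_sumr; apply: eq_bigr => s _; rewrite xk !mxE.
    by field.
  by rewrite !scale ay by_ mulr0.
have [z z0 ->] := pt_line q => /(L_pt _ _ z0)[az bz].
pose y : 'rV[K]_4 := \row_s (z 0 s / d s).
have xyE : \row_i ((\row_s d s) ord0 i * y ord0 i) = z.
  by apply/rowP => i; rewrite !mxE mulrC divfK.
have y0 : y != 0.
  apply: contra_neq z0 => y0; rewrite -xyE y0.
  by apply/rowP => i; rewrite !mxE mulr0.
exists (pt y).
  apply/L_pt => //; split.
    by rewrite -[RHS]az; apply: eq_bigr => s _; rewrite mxE mulrAC mulrA.
  by rewrite -[RHS]bz; apply: eq_bigr => s _; rewrite mxE mulrAC mulrA.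
by exists (\row_s d s), y; rewrite xyE; split=> //; rewrite line_pt // memv_line.
Qed.

End LinearStar.

Section PlanePairs.
Variables (K : numFieldType) (alpha beta : 'I_4 -> K).
Hypothesis ab_neq0 : forall s, alpha s * beta s != 0.
Hypothesis avoid_W : forall s, ~ W (pt1 (alpha s) (beta s)).

Definition row_param (k : nat) : K := k%:R / k.+1%:R.
Definition column_param (l : nat) : K := l.+1%:R^-1.

Let nat1_neq0 (k : nat) : k.+1%:R != 0 :> K.
Proof. by rewrite pnatr_eq0. Qed.

Lemma pencil_row k s : pencil alpha beta s (row_param k) =
  (alpha s + k%:R * beta s) / k.+1%:R.
Proof.
rewrite /pencil /row_param -natr1; field.
by rewrite natr1 nat1_neq0.
Qed.

Lemma pencil_column l s : pencil alpha beta s (column_param l) =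
  (l%:R * alpha s + beta s) / l.+1%:R.
Proof.
rewrite /pencil /column_param -natr1; field.
by rewrite natr1 nat1_neq0.
Qed.

Let alpha_neq0 s : alpha s != 0.
Proof. by have := ab_neq0 s; rewrite mulf_eq0 negb_or => /andP[]. Qed.

Let beta_neq0 s : beta s != 0.
Proof. by have := ab_neq0 s; rewrite mulf_eq0 negb_or => /andP[]. Qed.

Lemma pt1_scale (k x y : K) : k != 0 -> pt1 (k * x) (k * y) = pt1 x y.
Proof.
move=> k0; rewrite /pt1 -[RHS](pt_scale _ k0); congr pt.
by apply/rowP => i; rewrite !mxE; case: ifP.
Qed.

Lemma row_form_neq0 k s : alpha s + k%:R * beta s != 0.
Proof.
case: k => [|k]; first by rewrite mul0r addr0.
apply/eqP => E; apply: (@avoid_W s); exists k.+1 => //; right.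
rewrite -[RHS](@pt1_scale (alpha s)) // mulr1; congr pt1.
have -> : alpha s = - (k.+1%:R * beta s) by apply/eqP; rewrite -addr_eq0 E.
by rewrite mulrNN mulrAC divff // mul1r.
Qed.

Lemma column_form_neq0 l s : l%:R * alpha s + beta s != 0.
Proof.
case: l => [|l]; first by rewrite mul0r add0r.
apply/eqP => E; apply: (@avoid_W s); exists l.+1 => //; left.
rewrite -[RHS](@pt1_scale (alpha s)) // mulr1; congr pt1.
have -> : beta s = - (l.+1%:R * alpha s) by apply/eqP; rewrite -addr_eq0 addrC E.
by ring.
Qed.

Lemma row_regular k : regular alpha beta (row_param k).
Proof. by move=> s; rewrite pencil_row mulf_neq0 ?row_form_neq0 ?invr_eq0. Qed.

Lemma column_regular l : regular alpha beta (column_param l).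
Proof. by move=> s; rewrite pencil_column mulf_neq0 ?column_form_neq0 ?invr_eq0. Qed.

(** If e1 and e2 are the equations of the line, the two planes are multiples of l e1 + e2 and e1 + k
    e2, a change of basis with determinant k l - 1. *)
Lemma PQL_planes k l (q : proj K 3) : (k * l != 1)%N ->
  PQL alpha beta k l q <-> forall x : 'rV[K]_4, x \in line q ->
    plane alpha beta (row_param k) x = 0 /\ plane alpha beta (column_param l) x = 0.
Proof.
move=> kl; rewrite /PQL /P /Q star_linear; last first.
  by move=> s; rewrite mulf_neq0 ?invr_eq0 ?column_form_neq0.
rewrite star_linear; last first.
  by move=> s; rewrite mulf_neq0 ?invr_eq0 ?row_form_neq0.
pose e1 s := alpha s / ((l%:R * alpha s + beta s) / beta s) /
  ((alpha s + k%:R * beta s) / alpha s).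
pose e2 s := beta s / ((l%:R * alpha s + beta s) / beta s) /
  ((alpha s + k%:R * beta s) / alpha s).
have rowE (x : 'rV[K]_4) : plane alpha beta (row_param k) x =
    k.+1%:R * (l%:R * \sum_s e1 s * x ord0 s + \sum_s e2 s * x ord0 s).
  rewrite mulrDr !mulr_sumr -big_split; apply: eq_bigr => s _.
  rewrite pencil_row /e1 /e2 /=; move: (nat1_neq0 k); move: k.+1%:R => c c0; field.
  by rewrite c0 alpha_neq0 beta_neq0 row_form_neq0 column_form_neq0.
have columnE (x : 'rV[K]_4) : plane alpha beta (column_param l) x =
    l.+1%:R * (\sum_s e1 s * x ord0 s + k%:R * \sum_s e2 s * x ord0 s).
  rewrite mulrDr !mulr_sumr -big_split; apply: eq_bigr => s _.
  rewrite pencil_column /e1 /e2 /=; move: (nat1_neq0 l); move: l.+1%:R => c c0; field.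
  by rewrite c0 alpha_neq0 beta_neq0 row_form_neq0 column_form_neq0.
split=> H x /H.
  by move=> [E1 E2]; rewrite rowE columnE E1 E2 !mulr0 !addr0 !mulr0.
rewrite rowE columnE => -[/eqP + /eqP]; rewrite !mulf_eq0 !(negbTE (nat1_neq0 _)) /=.
set S1 := \sum_s e1 s * _; set S2 := \sum_s e2 s * _.
rewrite addrC addr_eq0 => /eqP S2E; rewrite S2E.
rewrite mulrN mulrA -natrM -{1}[S1]mul1r -mulrBl mulf_eq0 subr_eq0.
have /negbTE -> : 1 != (k * l)%:R :> K by rewrite (eqr_nat _ 1) eq_sym.
by move=> /eqP /= S10; rewrite S10 mulr0 oppr0.
Qed.

End PlanePairs.

(** * SI-sequences and the theorem *)

Section SISequences.
Local Open Scope nat_scope.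

(** When c_i <= i the expansion is C(i,i) + C(i-1,i-1) + ..., a sum of c_i ones, and the shift
    leaves every term equal to 1. *)
Lemma O_sequence_step c i : O_sequence c -> 1 <= i -> c i <= i -> c i.+1 <= c i.
Proof.
move=> [_ cO] i1 ci; pose ns := [seq i - k | k <- iota 0 (c i)].
have ns_size : size ns = c i by rewrite size_map size_iota.
have nsE k : k < c i -> nth 0 ns k = i - k.
  by move=> kc; rewrite (nth_map 0) ?size_iota // nth_iota.
have := cO i i1 ns; rewrite /binomial_shift ns_size.
rewrite (eq_bigr (fun=> 1)) => [|k _]; last by rewrite nsE // binn.
rewrite sum_nat_const card_ord muln1; apply; split; first by rewrite ns_size.
  rewrite ns_size; apply/(sortedP 0) => k; rewrite size_rcons ns_size ltnS => kc.
  rewrite !nth_rcons ns_size kc nsE //=; case: (ltnP k.+1 (c i)) => [kc'|ck].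
    by rewrite nsE //; lia.
  by have -> : k.+1 == c i; [apply/eqP; lia|lia].
rewrite ns_size (eq_bigr (fun=> 1)) => [|k _]; last by rewrite nsE // binn.
by rewrite sum_nat_const card_ord muln1.
Qed.

(** The value i + 1 = C(i+1,i) permits at most C(i+2,i+1) = i + 2 next, and smaller values cannot
    grow. *)
Lemma O_sequence_le c i : O_sequence c -> c 1 <= 2 -> c i <= i.+1.
Proof.
move=> cO c1; have [c0 cS] := cO.
elim: i => [|[|i] IH]; rewrite ?c0 //.
have [ci|ci] := leqP (c i.+1) i.+1.
  by apply: leq_trans (O_sequence_step cO _ ci) _ => //; lia.
have {IH ci} ci : c i.+1 = i.+2 by lia.
have := cS i.+1 isT [:: i.+2]; rewrite /binomial_shift big_ord1 /= subn0 binSn.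
apply; split=> //=; first by rewrite andbT /gtn /=; lia.
by rewrite big_ord1 /= subn0 binSn.
Qed.

Variables (s t : nat) (h : seq nat).
Hypothesis h_size : size h = s.+1.
Hypothesis h_SI : SI_sequence h.
Hypothesis h1 : nth 0 h 1 = 3.
Hypothesis t1 : 1 <= t.
Hypothesis ts : 2 * t <= s.
Hypothesis h_flat : forall i, t <= i <= s - t -> nth 0 h i = nth 0 h t.
Local Notation a := (difference h).

Let s_half : t <= s./2.
Proof. by rewrite geq_half_double -mul2n. Qed.

Let cut i := if i <= s./2 then a i else 0.

Let SI : [/\ nth 0 h 0 = 1 /\ nth 0 h s = 1,
  forall i, i <= s -> nth 0 h i = nth 0 h (s - i),
  forall i, i < s./2 -> nth 0 h i <= nth 0 h i.+1 & O_sequence cut].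
Proof. by have := h_SI; rewrite /SI_sequence h_size. Qed.

Let cutE i : i <= t -> cut i = a i.
Proof. by move=> it; rewrite /cut (leq_trans it). Qed.

Let cut1 : cut 1 <= 2.
Proof. by rewrite cutE // /= h1; case: SI => -[-> _]. Qed.

Lemma difference_le d : d <= t -> a d <= d.+1.
Proof. by move=> dt; rewrite -cutE //; apply: O_sequence_le cut1; case: SI. Qed.

Lemma difference_step d : d < t -> a d <= d -> a d.+1 <= a d.
Proof.
move=> dt ad; rewrite -[in X in X <= _]cutE // -cutE ?(ltnW dt) //.
have [d0|d1] := posnP d; first by move: ad; rewrite d0 /=; case: SI => -[-> _].
by apply: O_sequence_step => //; [case: SI|rewrite cutE // ltnW].
Qed.

Lemma sum_difference k : k <= t -> \sum_(0 <= d < k.+1) a d = nth 0 h k.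
Proof.
elim: k => [|k IH] kt; first by rewrite big_nat1.
rewrite big_nat_recr //= IH ?(ltnW kt) // subnKC //.
by case: SI => _ _ + _; apply; apply: leq_trans s_half.
Qed.

Lemma sum_difference_lt b k :
  \sum_(0 <= d < k) a d * (d < b) = \sum_(0 <= d < minn b k) a d.
Proof.
elim: k => [|k IH]; first by rewrite minn0 !big_geq.
rewrite big_nat_recr //= IH; have [kb|bk] := boolP (k < b).
  have -> : minn b k = k by lia.
  have -> : minn b k.+1 = k.+1 by lia.
  by rewrite muln1 big_nat_recr.
have -> : minn b k.+1 = minn b k by lia.
by rewrite muln0 addn0.
Qed.

(** By symmetry [h] loses a_d when the index passes from s - d to s - d + 1, so one formula covers
    ascent, plateau and descent. The subtracted sum stands on the left to match [degree_count]. *)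
Lemma SI_sum e :
  nth 0 h e + \sum_(0 <= d < t.+1) a d * (s < e + d) =
  \sum_(0 <= d < t.+1) a d * (d <= e).
Proof.
have split_sum : \sum_(0 <= d < t.+1) a d * (s < e + d) +
    \sum_(0 <= d < minn (s.+1 - e) t.+1) a d = nth 0 h t.
  rewrite -sum_difference_lt -big_split -[RHS]sum_difference //=.
  apply: eq_bigr => d _; rewrite -mulnDr -[RHS]muln1; congr (_ * _).
  by case: ltnP => ?; case: ltnP => ? //; lia.
rewrite [RHS](sum_difference_lt e.+1).
have [_ h_sym _ _] := SI.
have [et|te] := leqP e t.
  have E1 : minn e.+1 t.+1 = e.+1 by lia.
  have E2 : minn (s.+1 - e) t.+1 = t.+1 by lia.
  by move: split_sum; rewrite E1 E2 !sum_difference //; lia.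
have -> : minn e.+1 t.+1 = t.+1 by lia.
rewrite sum_difference //.
have [es|se] := leqP e (s - t).
  have E2 : minn (s.+1 - e) t.+1 = t.+1 by lia.
  by move: split_sum; rewrite E2 sum_difference // h_flat ?(ltnW te) //; lia.
have [es|es] := leqP e s; last first.
  have E2 : minn (s.+1 - e) t.+1 = 0 by lia.
  have e0 : nth 0 h e = 0 by rewrite nth_default // h_size.
  by move: split_sum; rewrite E2 [X in _ + X = _]big_geq // e0; lia.
have E2 : minn (s.+1 - e) t.+1 = (s - e).+1 by lia.
move: split_sum; rewrite E2 sum_difference ?(h_sym e) //; lia.
Qed.

End SISequences.

(** * The intersections of the theorem as triple points *)

Section TriplePoints.
Variable K : numFieldType.

Lemma bracket_pt1_neq0 (alpha beta : 'I_4 -> K) i j :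
  (forall s, alpha s * beta s != 0) ->
  injective (fun s => pt1 (alpha s) (beta s)) -> i != j -> bracket alpha beta i j != 0.
Proof.
move=> ab0 pt_inj; apply: contra_neq => /eqP; rewrite subr_eq0 => /eqP E.
have := ab0 i; have := ab0 j; rewrite !mulf_eq0 !negb_or => /andP[aj bj] /andP[ai bi].
apply: pt_inj; rewrite -(@pt1_scale _ (alpha i / alpha j) (alpha j)).
  by rewrite divfK // mulrAC -E mulfK.
by rewrite mulf_neq0 ?invr_eq0.
Qed.

Lemma row_param_inj : injective (@row_param K).
Proof.
move=> k k' /eqP; rewrite /row_param eqr_div ?pnatr_eq0 // -!natrM eqr_nat.
by rewrite !mulnS (mulnC k') eqn_add2r => /eqP.
Qed.

Lemma column_param_inj : injective (@column_param K).
Proof. by move=> l l' /invr_inj/eqP; rewrite eqr_nat => /eqP[]. Qed.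

Lemma row_column_param k l : k != 1%N -> row_param K k != column_param K l.
Proof.
move=> k1; rewrite /row_param /column_param -[X in _ != X]div1r.
rewrite eqr_div ?pnatr_eq0 // -natrM mul1r eqr_nat.
by apply: contra k1; rewrite mulnS -[in X in _ == X]addn1 eqn_add2l muln_eq1 => /andP[].
Qed.

Variables (alpha beta : 'I_4 -> K).
Hypothesis ab_neq0 : forall s, alpha s * beta s != 0.
Hypothesis bracket_neq0 : forall i j, i != j -> bracket alpha beta i j != 0.
Hypothesis avoid_W : forall s, ~ W (pt1 (alpha s) (beta s)).

Let row_reg := row_regular ab_neq0 avoid_W.
Let column_reg := column_regular ab_neq0 avoid_W.

(* The parameter [column_param 1 = 1 / 2] is excluded by [u i <> 1 <> v j], so it
   provides a plane missing all the points. *)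
Lemma three_planes_point a b c : uniq [:: a; b; c; column_param K 1] ->
  regular alpha beta a -> regular alpha beta b -> regular alpha beta c ->
  [set q : proj K 3 | forall x : 'rV[K]_4, x \in line q ->
     [/\ plane alpha beta a x = 0, plane alpha beta b x = 0 & plane alpha beta c x = 0]]
  = [set pt (triple_point alpha beta a b c)].
Proof.
move=> abcd ra rb rc; have rd := column_reg 1.
have p0 : triple_point alpha beta a b c != 0.
  apply: (triple_point_neq0 ab_neq0 bracket_neq0 rd); move: abcd => /=;
  by rewrite !inE !negb_or => /and4P[/and3P[_ _ ad] /andP[_ bd] cd _].
apply/seteqP; split=> q /=.
  have [x x0 ->] := pt_line q => H.
  have [|ax bx cx] := H x; first by rewrite line_pt // memv_line.
  have [k xk] := three_planes ab_neq0 bracket_neq0 abcd ra rb rc rd ax bx cx.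
  rewrite xk pt_scale //; apply: contra_neq x0 => k0.
  by rewrite xk k0 scale0r.
move=> -> x; rewrite line_pt // => /vlineP[k ->].
have vanish d : regular alpha beta d -> d \in [:: a; b; c] ->
    plane alpha beta d (k *: triple_point alpha beta a b c) = 0.
  move=> rd' din; rewrite planeZ; apply/eqP; rewrite mulf_eq0.
  by rewrite plane_triple_point_eq0 // orbC; move: din; rewrite !inE !(eq_sym d) => ->.
by split; apply: vanish; rewrite ?inE ?eqxx ?orbT.
Qed.

Variables u v : nat -> nat.

Lemma G1_point i j k : u i <> 1%N -> v j <> 1%N -> v k <> 1%N -> v j != v k ->
  G1 alpha beta u v i j k = [set pt (triple_point alpha beta (row_param K (u i))
    (column_param K (v j)) (column_param K (v k)))].
Proof.
move=> /eqP ui /eqP vj /eqP vk jk; rewrite -three_planes_point //; last first.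
  rewrite /= !inE !negb_or !(inj_eq column_param_inj) jk vj vk.
  by rewrite !row_column_param.
have nu l : (u i * l != 1)%N by rewrite muln_eq1 negb_and ui.
rewrite /G1; apply/seteqP; split=> q.
  by move=> [/(PQL_planes ab_neq0 avoid_W _ (nu _)) H
    /(PQL_planes ab_neq0 avoid_W _ (nu _)) H'] x xq;
    have [? ?] := H x xq; have [? ?] := H' x xq.
by move=> H; split; apply/(PQL_planes ab_neq0 avoid_W _ (nu _)) => x /H[].
Qed.

Lemma G2_point i k j : u i <> 1%N -> u k <> 1%N -> v j <> 1%N -> u i != u k ->
  G2 alpha beta u v i k j = [set pt (triple_point alpha beta (row_param K (u i))
    (column_param K (v j)) (row_param K (u k)))].
Proof.
move=> /eqP ui /eqP uk /eqP vj ik; rewrite -three_planes_point //; last first.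
  rewrite /= !inE !negb_or (inj_eq column_param_inj) (inj_eq row_param_inj) ik vj.
  by rewrite [column_param _ _ == _]eq_sym !row_column_param.
have nu l : (u i * l != 1)%N by rewrite muln_eq1 negb_and ui.
have nu' l : (u k * l != 1)%N by rewrite muln_eq1 negb_and uk.
rewrite /G2; apply/seteqP; split=> q.
  by move=> [/(PQL_planes ab_neq0 avoid_W _ (nu _)) H
    /(PQL_planes ab_neq0 avoid_W _ (nu' _)) H'] x xq;
    have [? ?] := H x xq; have [? ?] := H' x xq.
by move=> H; split; [apply/(PQL_planes ab_neq0 avoid_W _ (nu _)) |
  apply/(PQL_planes ab_neq0 avoid_W _ (nu' _))] => x /H[].
Qed.

End TriplePoints.

Theorem theorem6p1 (R : realType) (s t : nat) (h : seq nat)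
    (alpha beta : 'I_4 -> R[i]) (u v : nat -> nat) :
  let a := difference h in
  let G_first := fun i j k : nat =>
       [/\ (i <= t)%N, (j < a i)%N & (a i <= k <= s - t + 1)%N] in
  let G_second := fun i k j : nat =>
       (i < k <= t)%N /\ (minn (a i) (a k) <= j < maxn (a i) (a k))%N in
  let X := [set p | (exists i j k, G_first i j k /\ G1 alpha beta u v i j k p) \/
              (exists i k j, G_second i k j /\ G2 alpha beta u v i k j p)] in
  size h = s.+1 ->
  SI_sequence h ->
  nth 0%N h 1 = 3%N ->
  (1 <= t)%N -> (2 * t <= s)%N ->
  (forall i, (t <= i <= s - t)%N -> nth 0%N h i = nth 0%N h t) ->
  (forall i, alpha i * beta i != 0) ->
  injective (fun i => pt1 (alpha i) (beta i)) ->
  (forall i, ~ W (pt1 (alpha i) (beta i))) ->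
  u 0%N = 0%N ->
  (forall i j, (i < j <= t)%N -> (u i < u j)%N) ->
  (forall i, (i <= t)%N -> u i <> 1%N) ->
  v 0%N = 0%N ->
  (forall i j, (i < j <= s - t + 1)%N -> (v i < v j)%N) ->
  (forall i, (i <= s - t + 1)%N -> v i <> 1%N) ->
  [/\ forall i j k, G_first i j k ->
        exists p, G1 alpha beta u v i j k = [set p],
      forall i k j, G_second i k j ->
        exists p, G2 alpha beta u v i k j = [set p],
      gorenstein_zeroscheme X &
      forall d, h_vector X d = (nth 0%N h d)%:Z].
Proof.
move=> a G_first G_second X h_size h_SI h1 t1 ts h_flat ab0 pt_inj avoid_W _
  u_lt u1 _ v_lt v1.
have br0 i j := @bracket_pt1_neq0 _ alpha beta i j ab0 pt_inj.
have a_le d : (d < t.+1)%N -> (a d <= d.+1)%N.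
  exact: (difference_le h_size h_SI h1 t1 ts).
have a_step d : (d.+1 < t.+1)%N -> (a d <= d)%N -> (a d.+1 <= a d)%N.
  exact: (difference_step h_size h_SI ts).
pose n := (s - t + 2)%N.
have a_n d : (d < t.+1)%N -> (a d <= n)%N.
  by move=> dt; have := a_le _ dt; rewrite /n; lia.
have strict_inj (w : nat -> nat) b : (forall i j, i < j <= b -> w i < w j)%N ->
    forall i j, (i <= b)%N -> (j <= b)%N -> i != j -> w i != w j.
  move=> w_lt i j ib jb; rewrite neq_ltn => /orP[ij|ji].
    by rewrite ltn_eqF // w_lt // ij.
  by rewrite gtn_eqF // w_lt // ji.
have u_neq := strict_inj u _ u_lt; have v_neq := strict_inj v _ v_lt.
have first_point i j k : G_first i j k -> G1 alpha beta u v i j k =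
    [set pt (triple_point alpha beta (row_param _ (u i)) (column_param _ (v j))
      (column_param _ (v k)))].
  move=> [it ji /andP[ik kn]]; have ai := a_le i it.
  by apply: G1_point => //; [exact: u1|apply: v1; lia|exact: v1|apply: v_neq; lia].
have second_point i k j : G_second i k j -> G2 alpha beta u v i k j =
    [set pt (triple_point alpha beta (row_param _ (u i)) (column_param _ (v j))
      (row_param _ (u k)))].
  move=> [/andP[ik kt] /andP[_ jmax]].
  have ai := a_le i (leq_trans ik (leqW kt)); have ak := a_le k kt.
  by apply: G2_point => //; [apply: u1; lia|exact: u1|apply: v1; lia|apply: u_neq; lia].
(* The sequence a rises before it falls; renumbering the rows by decreasing a leaves the set of
   points unchanged and makes [lam] a partition. *)
pose sigma := sort (fun i k => a k <= a i)%N (iota 0 t.+1).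
have sigma_perm : perm_eq sigma (iota 0 t.+1) by rewrite perm_sort.
have sigma_size : size sigma = t.+1 by rewrite size_sort size_iota.
have sigma_uniq : uniq sigma by rewrite sort_uniq iota_uniq.
have sigma_le i : (i < t.+1)%N -> (nth 0 sigma i <= t)%N.
  by move=> it; have := mem_nth 0 (s := sigma) (n := i);
    rewrite sigma_size mem_sort mem_iota => /(_ it).
have sigma_neq i k : (i < t.+1)%N -> (k < t.+1)%N -> i != k ->
    nth 0%N sigma i != nth 0%N sigma k.
  by move=> it kt; rewrite nth_uniq ?sigma_size.
have sigma_onto i : (i <= t)%N -> exists i' : 'I_t.+1, nth 0%N sigma i' = i.
  move=> it; have i_sigma : i \in sigma by rewrite mem_sort mem_iota.
  have it' : (index i sigma < t.+1)%N by rewrite -sigma_size index_mem.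
  by exists (Ordinal it'); rewrite /= nth_index.
pose lam i := a (nth 0%N sigma i).
have lam_sorted i k : (i <= k < t.+1)%N -> (lam k <= lam i)%N.
  move=> /andP[ik kt].
  have tr : transitive (fun i k => a k <= a i)%N by move=> x y z yx zx; apply: leq_trans yx.
  apply: (sorted_leq_nth tr _ 0 (sort_sorted _ _)) => //.
  - by move=> x y; apply: leq_total.
  - by rewrite inE sigma_size (leq_ltn_trans ik).
  - by rewrite inE sigma_size.
have lam_le i : (i < t.+1)%N -> (lam i <= n)%N.
  by move=> /sigma_le it; apply: a_n.
pose theta (c : 'I_t.+1 + 'I_n) : R[i] := match c with
  | inl i => row_param _ (u (nth 0%N sigma i))
  | inr j => column_param _ (v j)
  end.
have u1' (i : 'I_t.+1) : u (nth 0%N sigma i) != 1%N.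
  by apply/eqP; apply: u1; apply: sigma_le.
have v1' (j : 'I_n) : v j != 1%N by apply/eqP; apply: v1; have := ltn_ord j; rewrite /n; lia.
have theta_inj : injective theta.
  move=> [i|j] [k|l] /= /eqP.
  - rewrite (inj_eq (@row_param_inj _)) => E; congr inl; apply/val_inj/eqP.
    apply/negPn/negP => /(sigma_neq _ _ (ltn_ord i) (ltn_ord k)) ik.
    by move: E; apply/negP; apply: u_neq => //; apply: sigma_le.
  - by rewrite (negbTE (row_column_param _ _ _)).
  - by rewrite eq_sym (negbTE (row_column_param _ _ _)).
  - rewrite (inj_eq (@column_param_inj _)) => E; congr inr; apply/val_inj/eqP.
    apply/negPn/negP => jl; move: E; apply/negP; apply: v_neq => //.
      by have := ltn_ord j; rewrite /n; lia.
    by have := ltn_ord l; rewrite /n; lia.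
have theta_reg c : regular alpha beta (theta c).
  by case: c => k; [apply: row_regular|apply: column_regular].
have z_theta c : theta c != column_param _ 1.
  by case: c => k /=; rewrite ?row_column_param // (inj_eq (@column_param_inj _)).
have mn : (t.+1 + n = s + 3)%N by rewrite /n; lia.
have count e : #|[pred x : 'I_t.+1 * 'I_n * ('I_t.+1 + 'I_n) |
    configuration (fun i => lam i) x & separator_degree (fun i => lam i) x == e]| =
    nth 0%N h e.
  rewrite (card_configuration lam mn).
  (* With the descent sum added, [SI_sum] expresses the side of [h] through d, and both sums over d
     become sums over boxes with d = i + j. *)
  apply/eqP; rewrite -(eqn_add2r (\sum_(0 <= d < t.+1) a d * (s < e + d)%N)%N).
  rewrite (SI_sum h_size h_SI h1 t1 ts h_flat).
  rewrite -!(box_sum_diagonals (n := n) _ lam_sorted sigma_perm) //.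
  by rewrite (degree_count lam_sorted lam_le e mn).
have [_ h_sym _ _] := h_SI; rewrite h_size /= in h_sym.
have [] := configuration_gorenstein ab0 br0 theta_inj theta_reg
  (column_regular ab0 avoid_W 1) z_theta mn lam_sorted lam_le count h_sym.
- by move=> e se; rewrite nth_default // h_size.
- by case: h_SI => -[-> _].
- by lia.
suff -> : X = configuration_set alpha beta theta lam.
  move=> gor hv; split=> // i j k.
    by move=> /first_point ->; eexists.
  by move=> /second_point ->; eexists.
apply/seteqP; split=> q.
  move=> [[i [j [k [Gijk]]]]|[i [k [j [Gikj]]]]].
    rewrite first_point // => ->; case: Gijk => it ji /andP[ik kn].
    have [i' i'E] := sigma_onto i it; have ai := a_le i it.
    have jn : (j < n)%N by rewrite /n; lia.
    have kn' : (k < n)%N by rewrite /n; lia.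
    exists (i', Ordinal jn, inr (Ordinal kn')).
      by rewrite /configuration /= /lam i'E ji.
    by rewrite /index_point /= i'E.
  rewrite second_point // => ->; case: Gikj => /andP[ik kt] jik.
  have it : (i <= t)%N by apply: leq_trans kt; apply: ltnW.
  have [i' i'E] := sigma_onto i it; have [k' k'E] := sigma_onto k kt.
  have ai := a_le i it; have ak := a_le k kt.
  have jn : (j < n)%N by rewrite /n; lia.
  (* The line of the curve lies in the row with the larger a, so the roles of i and k are exchanged
     when j >= a_i. *)
  have [ji|aij] := boolP (j < a i)%N.
    exists (i', Ordinal jn, inl k').
      by rewrite /configuration /= /lam i'E k'E ji; lia.
    by rewrite /index_point /= i'E k'E.
  exists (k', Ordinal jn, inl i').
    by rewrite /configuration /= /lam i'E k'E; apply/andP; split; lia.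
  rewrite /index_point /= i'E k'E; apply: (congr1 (@pt _ 3)); exact: triple_pointCl.
move=> [[[i j] [k|k]] /andP[/= ji kP] ->].
  have it := sigma_le i (ltn_ord i); have kt := sigma_le k (ltn_ord k).
  right; have [ik|ki|E] := ltngtP (nth 0%N sigma i) (nth 0%N sigma k).
  - exists (nth 0%N sigma i), (nth 0%N sigma k), j.
    have G : G_second (nth 0%N sigma i) (nth 0%N sigma k) j.
      by split; rewrite ?ik //; move: ji kP; rewrite /lam; lia.
    by rewrite second_point.
  - exists (nth 0%N sigma k), (nth 0%N sigma i), j.
    have G : G_second (nth 0%N sigma k) (nth 0%N sigma i) j.
      by split; rewrite ?ki //; move: ji kP; rewrite /lam; lia.
    split; first exact: G.
    rewrite (second_point _ _ _ G); apply: (congr1 (@pt _ 3)); exact: triple_pointCl.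
  - by move: ji kP; rewrite /lam E; lia.
left; exists (nth 0%N sigma i), j, k.
have G : G_first (nth 0%N sigma i) j k.
  split=> //; first exact: sigma_le.
  by rewrite kP /=; have := ltn_ord k; rewrite /n; lia.
by rewrite first_point.
Qed.
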